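(* Let $\mathcal G$ be a connected noncompact metric graph with at least one terminal point, and consider the critical energy ($p=6$). Then: $\mu_{\mathcal G}=\mu_{\mathbb R^+}$; for every $\mu\in(\mu_{\mathbb R^+},\mu_{\mathbb R}]$, $\mathcal E_{\mathcal G}(\mu)=-\infty$; and for $\mu=\mu_{\mathbb R^+}$, $\mathcal E_{\mathcal G}(\mu)=0$, and this value is attained if and only if $\mathcal G$ is a halfline.
   Context: Metric graphs have finitely many edges and vertices, bounded edges identified with $[0,\ell_e]$ and halflines with $[0,\infty)$ (whose far endpoints are vertices at infinity); noncompact means at least one halfline. A terminal point is a vertex of degree one that is not a vertex at infinity (the free endpoint of a bounded edge). $H^1(\mathcal G)$: continuous functions, $H^1$ on each edge; $H^1_\mu(\mathcal G)$: those with $\|u\|_2^2=\mu$. $E(u,\mathcal G)=\frac12\int|u'|^2-\frac16\int|u|^6$, $\mathcal E_{\mathcal G}(\mu)=\inf_{H^1_\mu(\mathcal G)}E(\cdot,\mathcal G)$. For a graph $X$, $K_X=\sup_{u\in H^1(X),u\ne0}\frac{\|u\|_6^6}{\|u\|_2^4\|u'\|_2^2}$ and $\mu_X=\sqrt{3/K_X}$; in particular $\mu_{\mathbb R}=\pi\sqrt3/2$ and $\mu_{\mathbb R^+}=\pi\sqrt3/4$. *)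

(* Defs.v *)
From HB Require Import structures.
From mathcomp Require Import all_boot all_order all_algebra.
From mathcomp Require Import all_classical all_reals all_analysis.

Unset Strict Implicit.
Unset Printing Implicit Defensive.

Import Order.TTheory GRing.Theory Num.Theory.
Local Open Scope classical_set_scope.
Local Open Scope ring_scope.

(* Metric graphs with finitely many vertices and edges.                      *)
(* Finite vertices are 'I_nV.  Each edge e : 'I_nE is either bounded         *)
(* (bnd e = true), identified with [0, len e], its endpoint 0 attached to    *)
(* src e and its endpoint len e attached to tgt e; or a halfline             *)
(* (bnd e = false), identified with [0, +oo), its endpoint 0 attached to     *)
(* src e and its far endpoint being its own vertex at infinity (tgt e is     *)
(* then irrelevant).                                                         *)
Record graph (R : realType) := MkGraph {
  nV : nat;
  nE : nat;
  bnd : 'I_nE -> bool;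
  len : 'I_nE -> R;
  src : 'I_nE -> 'I_nV;
  tgt : 'I_nE -> 'I_nV }.
Arguments nV {R} g.
Arguments nE {R} g.
Arguments bnd {R} g _.
Arguments len {R} g _.
Arguments src {R} g _.
Arguments tgt {R} g _.

Section Graphs.
Variable R : realType.
Implicit Types G : graph R.

Definition wf_graph G : Prop := forall e, bnd G e -> 0 < len G e.

Definition edge_dom G (e : 'I_(nE G)) : set R :=
  if bnd G e then `[0, len G e]%classic else `[0, +oo[%classic.

(* degree of a finite vertex (a self-loop counts twice) *)
Definition degree G (v : 'I_(nV G)) : nat :=
  #|[set e | src G e == v]| + #|[set e | bnd G e && (tgt G e == v)]|.

Definition adj G : rel 'I_(nV G) :=
  fun v w => [exists e, bnd G e && (((src G e == v) && (tgt G e == w))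
                                   || ((src G e == w) && (tgt G e == v)))].

(* connectedness: all finite vertices are joined by paths of bounded edges
   (halflines hang at finite vertices, so this is connectedness of G) *)
Definition connected_graph G : Prop :=
  (0 < nV G)%N /\ forall v w : 'I_(nV G), connect (adj G) v w.

Definition noncompact G : Prop := exists e, ~~ bnd G e.

(* terminal point: finite vertex (i.e. not a vertex at infinity) of degree 1 *)
Definition has_terminal_point G : Prop := exists v, degree G v = 1%N.

(* G is a halfline (up to inessential vertices of degree 2): exactly one
   halfline and every finite vertex has degree at most 2; for a connected
   graph this means G is isometric to [0, +oo). *)
Definition is_halfline G : Prop :=
  #|[set e | ~~ bnd G e]| = 1%N /\ forall v, (degree G v <= 2)%N.

(* H^1(G): a function u on G is a family u e of real functions on the edges, *)
(* du e is its (weak) derivative on the edge.  On an interval, H^1 is the    *)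
(* space of absolutely continuous functions u with u, u' in L^2:             *)
(* u e x = u e 0 + int_0^x du e.  Continuity on G = agreement at vertices.   *)
Definition is_H1 G (u du : 'I_(nE G) -> R -> R) : Prop :=
  (forall e, measurable_fun (edge_dom G e) (u e)) /\
  (forall e, measurable_fun (edge_dom G e) (du e)) /\
  (forall e, (\int[lebesgue_measure]_(x in edge_dom G e) ((u e x) ^+ 2)%:E
                < +oo)%E) /\
  (forall e, (\int[lebesgue_measure]_(x in edge_dom G e) ((du e x) ^+ 2)%:E
                < +oo)%E) /\
  (forall e x, edge_dom G e x ->
     (\int[lebesgue_measure]_(t in `[0%R, x]%classic) (du e t)%:E)%E
       = (u e x - u e 0)%:E) /\
  (exists phi : 'I_(nV G) -> R, forall e,
     u e 0 = phi (src G e) /\ (bnd G e -> u e (len G e) = phi (tgt G e))).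

Definition Lp_pow G (p : nat) (u : 'I_(nE G) -> R -> R) : \bar R :=
  (\sum_(e < nE G)
     \int[lebesgue_measure]_(x in edge_dom G e) (`|u e x| ^+ p)%:E)%E.

Definition mass G u := Lp_pow G 2 u.

Definition energy G (u du : 'I_(nE G) -> R -> R) : \bar R :=
  ((2^-1)%:E * Lp_pow G 2 du - (6^-1)%:E * Lp_pow G 6 u)%E.

Definition ground_energy G (mu : R) : \bar R :=
  ereal_inf [set y | exists u du,
     is_H1 G u du /\ mass G u = mu%:E /\ y = energy G u du].

Definition GN_ratio G (u du : 'I_(nE G) -> R -> R) : \bar R :=
  if fine (Lp_pow G 2 du) == 0 then +oo%E
  else (fine (Lp_pow G 6 u) / ((fine (mass G u)) ^+ 2 * fine (Lp_pow G 2 du)))%:E.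

Definition K_const G : \bar R :=
  ereal_sup [set y | exists u du,
     is_H1 G u du /\ mass G u != 0%E /\ y = GN_ratio G u du].

(* mu_X = sqrt(3 / K_X)   (= 0 when K_X = +oo) *)
Definition mu_crit G : R := Num.sqrt (3 / fine (K_const G)).

(* the halfline R^+ and the line R (two halflines glued at one vertex) *)
Definition halfline_graph : graph R :=
  @MkGraph R 1 1 (fun _ => false) (fun _ => 0) (fun _ => ord0) (fun _ => ord0).

Definition line_graph : graph R :=
  @MkGraph R 1 2 (fun _ => false) (fun _ => 0) (fun _ => ord0) (fun _ => ord0).

End Graphs.
Arguments wf_graph {R}.
Arguments edge_dom {R}.
Arguments degree {R}.
Arguments adj {R}.
Arguments connected_graph {R}.
Arguments noncompact {R}.
Arguments has_terminal_point {R}.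
Arguments is_halfline {R}.
Arguments is_H1 {R}.
Arguments Lp_pow {R}.
Arguments mass {R}.
Arguments energy {R}.
Arguments ground_energy {R}.
Arguments GN_ratio {R}.
Arguments K_const {R}.
Arguments mu_crit {R}.

(* Main.v *)
Require Import Defs.
From HB Require Import structures.
From mathcomp Require Import all_boot all_order all_algebra.
From mathcomp Require Import all_classical all_reals all_analysis.
From mathcomp Require Import measurable_realfun ring lra.
Import Order.TTheory GRing.Theory Num.Theory.
Import numFieldNormedType.Exports.
Set Implicit Arguments.
Unset Strict Implicit.
Unset Printing Implicit Defensive.
Local Open Scope classical_set_scope.
Local Open Scope ring_scope.

(** The inequality behind the theorem is [int u'^2 >= b^2 int u^6] with
    [b = pi / (4 m)], [m] the mass of [u].  Along a path running from a point where
    [|u| = M] is maximal to infinity, let [s] be the mass still ahead.  Completing the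
    square in [u' + b tan (c - 2 b s) u^3], whose cross term is the derivative of
    [b tan (c - 2 b s) u^4 / 2] up to a multiple of [u^6], bounds
    [int (u'^2 - b^2 u^6)] on the path below by [b M^4 tan (2 b m_r) / 2], where [m_r]
    is the mass off the path (take [c = pi / 2]); off the path [int u^6] is at most
    [M^4 m_r], and [tan x >= x] concludes.  Equality forces [m_r = 0].  Cutting the path
    at a point with mass [s] ahead and using two different values of [c] on the two sides
    then shows that [u <> 0] when [s > 0] and that [u^2 <= C s], so by Gronwall's lemma
    [s] never vanishes; hence [u] vanishes nowhere on the path but identically off it, and
    the path is all of [G].

    Sharpness comes from the optimiser [sqrt (sech x)], concentrated near the terminal
    point and lowered by a constant to vanish at the other end of a bounded edge.  On any
    noncompact graph, spreading a function along a halfline brings its energy to zero. *)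

(** * Absolutely continuous functions on a segment *)

Section SegmentIntegral.
Context {R : realType}.
Local Notation mu := (@lebesgue_measure R).
Implicit Types (f g : R -> R) (a b x y r : R) (c : itv_bound R).

Lemma lebesgue_measure_seg x y : x <= y -> mu `[x, y]%classic = (y - x)%:E.
Proof.
move=> xy; rewrite lebesgue_measure_itv /= lte_fin EFinB; case: ltgtP xy => // -> _.
by rewrite subee.
Qed.

Lemma Rintegral_itv_cat f a b c : mu.-integrable [set` Interval (BLeft a) c] (EFin \o f) ->
  a <= b -> (BRight b <= c)%O ->
  \int[mu]_(t in `[a, b]) f t + \int[mu]_(t in [set` Interval (BLeft b) c]) f t =
  \int[mu]_(t in [set` Interval (BLeft a) c]) f t.
Proof.
move=> itf ab bc; rewrite -(@Rintegral_itv_obnd_cbnd _ b).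
  by rewrite -(@Rintegral_itvB _ _ (BLeft a) c b) ?bnd_simp // addrC subrK.
by apply: integrableS itf => //; apply: subset_itvr; rewrite bnd_simp.
Qed.

Lemma ge0_subset_Rintegral f (D E : set R) : measurable D -> measurable E -> E `<=` D ->
  mu.-integrable D (EFin \o f) -> (forall t, 0 <= f t) ->
  \int[mu]_(t in E) f t <= \int[mu]_(t in D) f t.
Proof.
move=> mD mE ED itf f0; rewrite /Rintegral fine_le ?(@integrable_fin_num _ _ _ mu) //.
  exact: integrableS itf.
apply: ge0_subset_integral => //; first by case/integrableP: itf.
by move=> t _; rewrite lee_fin.
Qed.

Lemma Rintegral_cst_seg x y r : x <= y -> \int[mu]_(t in `[x, y]) r = r * (y - x).
Proof. by move=> xy; rewrite Rintegral_cst //= lebesgue_measure_seg. Qed.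

Lemma continuous_seg_integrable f x y : {within `[x, y], continuous f} ->
  mu.-integrable `[x, y]%classic (EFin \o f).
Proof. by apply: continuous_compact_integrable; exact: segment_compact. Qed.

Lemma integrable_cst_seg x y r : mu.-integrable `[x, y]%classic (EFin \o fun=> r).
Proof. by apply: continuous_seg_integrable; apply: continuous_subspaceT => t; exact: cvg_cst. Qed.

Lemma integrable_addf (D : set R) f g : measurable D -> mu.-integrable D (EFin \o f) ->
  mu.-integrable D (EFin \o g) -> mu.-integrable D (EFin \o (fun t => f t + g t)).
Proof. by move=> mD itf itg; exact: (@integrableD _ _ _ mu D mD _ _ itf itg). Qed.

Lemma integrable_scalef (D : set R) r f : measurable D -> mu.-integrable D (EFin \o f) ->
  mu.-integrable D (EFin \o (fun t => r * f t)).
Proof. by move=> mD itf; exact: (@integrableZl _ _ _ mu D mD r _ itf). Qed.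

Lemma integrable_mul_continuous f g x y : mu.-integrable `[x, y]%classic (EFin \o f) ->
  {within `[x, y], continuous g} ->
  mu.-integrable `[x, y]%classic (EFin \o (fun t => f t * g t)).
Proof.
move=> itf cg; apply: (@integrableMl _ _ _ mu _ _ (EFin \o f) g) => //.
  exact: subspace_continuous_measurable_fun.
have /compact_bounded[M [Mreal Mb]] := continuous_compact cg (@segment_compact _ x y).
by exists M; split => // N MN t xyt; apply: Mb => //; exists t.
Qed.

(* Halving the segment at a point where [E] takes its mean value halves the bound. *)
Lemma sqr_increment_cst (F E : R -> R) a b : a <= b -> {within `[a, b], continuous E} ->
  {in `[a, b] &, {homo E : x y / x <= y}} ->
  (forall x y, a <= x -> x <= y -> y <= b -> `|F y - F x| <= (E y - E x) ^+ 2) -> F b = F a.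
Proof.
move=> ab cE ndE FE.
have bound n x y : a <= x -> x <= y -> y <= b -> `|F y - F x| <= (E y - E x) ^+ 2 / 2 ^+ n.
  elim: n x y => [|n IHn] x y ax xy yb; first by rewrite expr0 divr1 FE.
  have Exy : E x <= E y by apply: ndE; rewrite ?in_itv //=; apply/andP; split; lra.
  have [||z] := @IVT _ E x y ((E x + E y) / 2) xy.
  - by apply: continuous_subspaceW cE; apply: subset_itv; rewrite bnd_simp.
  - by rewrite min_l // max_r //; apply/andP; split; lra.
  rewrite in_itv /= => /andP[xz zy] Ez.
  have Fyz := IHn z y (le_trans ax xz) zy yb; have Fzx := IHn x z ax xz (le_trans zy yb).
  have -> : F y - F x = (F y - F z) + (F z - F x) by ring.
  apply: le_trans (ler_normD _ _) _; apply: le_trans (lerD Fyz Fzx) _.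
  by rewrite Ez (exprS 2 n) invfM; lra.
apply/eqP; rewrite -subr_eq0 -normr_le0; set A := (E b - E a) ^+ 2.
have small n : `|F b - F a| * 2 ^+ n <= A by rewrite -ler_pdivlMr ?exprn_gt0 // bound.
rewrite leNgt; apply/negP => Fba; pose n := (Num.trunc (A / `|F b - F a|)).+1.
have := small n; apply/negP; rewrite -ltNge mulrC -ltr_pdivrMr //.
apply: lt_trans (truncnS_gt _) _.
by rewrite -natrX ltr_nat ltn_expl.
Qed.

End SegmentIntegral.

Section Primitive.
Context {R : realType}.
Local Notation mu := (@lebesgue_measure R).
Implicit Types (f g F G phi dphi : R -> R) (p q x y : R).

(* [F] is absolutely continuous on [[p, q]] with almost everywhere derivative [f]. *)
Definition primitive_on p q f F : Prop :=
  mu.-integrable `[p, q]%classic (EFin \o f) /\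
  forall x y, p <= x -> x <= y -> y <= q -> F y - F x = \int[mu]_(t in `[x, y]) f t.

Lemma integrable_sub_seg f p q x y : mu.-integrable `[p, q]%classic (EFin \o f) ->
  p <= x -> y <= q -> mu.-integrable `[x, y]%classic (EFin \o f).
Proof. by move=> itf px yq; apply: integrableS itf => //; apply: subset_itv. Qed.

Lemma primitive_on_sub f F p q x y : primitive_on p q f F -> p <= x -> y <= q ->
  primitive_on x y f F.
Proof.
move=> [itf FE] px yq; split; first exact: integrable_sub_seg itf px yq.
by move=> s t xs st ty; apply: FE; lra.
Qed.

Lemma primitive_on_integral f p q : mu.-integrable `[p, q]%classic (EFin \o f) ->
  primitive_on p q f (fun x => \int[mu]_(t in `[p, x]) f t).
Proof.
move=> itf; split=> // x y px xy yq; rewrite -(@Rintegral_itv_cat _ f p x (BRight y)) //.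
  by rewrite addrC addKr.
exact: integrable_sub_seg itf (lexx p) yq.
Qed.

Lemma primitive_on_affine f F p q a k : primitive_on p q f F ->
  primitive_on p q (fun x => k * f x) (fun x => a + k * F x).
Proof.
move=> [itf FE]; split=> [|x y px xy yq]; first exact: integrable_scalef.
rewrite RintegralZl //; last exact: integrable_sub_seg itf px yq.
by rewrite -(FE x y) //; ring.
Qed.

Lemma primitive_on_continuous f F p q : primitive_on p q f F ->
  {within `[p, q], continuous F}.
Proof.
move=> [itf FE]; have [pq|qp] := leP p q; last first.
  by rewrite set_itv_ge ?bnd_simp -?ltNge //; exact: continuous_subspace0.
have cI := parameterized_integral_continuous pq itf.
apply: (@subspace_eq_continuous _ _ _
  (fun x => F p + parameterized_integral mu p x f)).
  move=> x; rewrite inE /= in_itv /= => /andP[px xq].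
  by rewrite /parameterized_integral -(FE p x) // addrC subrK.
by move=> x; apply: cvgD; [exact: cvg_cst|exact: cI].
Qed.

Lemma primitive_on_dist f F p q x y : primitive_on p q f F -> p <= x -> x <= y -> y <= q ->
  `|F y - F x| <= \int[mu]_(t in `[p, q]) `|f t|.
Proof.
move=> [itf FE] px xy yq; rewrite FE //.
have itf' := integrable_sub_seg itf px yq.
have itnf : mu.-integrable `[p, q]%classic (EFin \o (fun t => `|f t|)) by exact: integrable_norm.
apply: le_trans (le_normr_Rintegral _ itf') _ => //.
by apply: ge0_subset_Rintegral => //; apply: subset_itv; rewrite bnd_simp.
Qed.

Lemma primitive_mul_increment f F g G p q : p <= q ->
  primitive_on p q f F -> primitive_on p q g G ->
  `|F q * G q - F p * G p - \int[mu]_(t in `[p, q]) (f t * G t + F t * g t)| <=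
  (\int[mu]_(t in `[p, q]) (`|f t| + `|g t|)) ^+ 2.
Proof.
move=> pq pF pG; have [itf FE] := pF; have [itg GE] := pG.
have itfG := integrable_mul_continuous itf (primitive_on_continuous pG).
have itFg : mu.-integrable `[p, q]%classic (EFin \o (fun t => F t * g t)).
  rewrite (_ : (fun t => F t * g t) = (fun t => g t * F t)).
    exact: integrable_mul_continuous itg (primitive_on_continuous pF).
  by apply/funext => t; rewrite mulrC.
have itnf : mu.-integrable `[p, q]%classic (EFin \o (fun t => `|f t|)) by exact: integrable_norm.
have itng : mu.-integrable `[p, q]%classic (EFin \o (fun t => `|g t|)) by exact: integrable_norm.
have itFqg := integrable_scalef (F q) (measurable_itv _) itg.
have itGpf := integrable_scalef (G p) (measurable_itv _) itf.
have -> : F q * G q - F p * G p - \int[mu]_(t in `[p, q]) (f t * G t + F t * g t) =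
    \int[mu]_(t in `[p, q]) (F q * g t + G p * f t - (f t * G t + F t * g t)).
  rewrite RintegralB ?RintegralD ?RintegralZl -?FE -?GE //; first by ring.
  - exact: integrable_addf.
  - exact: integrable_addf.
set a := \int[mu]_(t in `[p, q]) `|f t|; set b := \int[mu]_(t in `[p, q]) `|g t|.
have -> : \int[mu]_(t in `[p, q]) (`|f t| + `|g t|) = a + b by rewrite RintegralD.
have ab2 : a * b + b * a <= (a + b) ^+ 2.
  by have := sqr_ge0 a; have := sqr_ge0 b; lra.
have itan := integrable_scalef a (measurable_itv _) itng.
have itbn := integrable_scalef b (measurable_itv _) itnf.
have itd : mu.-integrable `[p, q]%classic
    (EFin \o (fun t => F q * g t + G p * f t - (f t * G t + F t * g t))).
  exact: (@integrableB _ _ _ mu _ _ _ _ (integrable_addf _ itFqg itGpf)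
    (integrable_addf _ itfG itFg)).
apply: le_trans (le_normr_Rintegral _ itd) _ => //; apply: le_trans ab2.
rewrite -{1}RintegralZl // -RintegralZl // -RintegralD //.
apply: le_Rintegral => //; [exact: integrable_norm|exact: integrable_addf|].
move=> t; rewrite /= in_itv /= => /andP[pt tq].
have -> : F q * g t + G p * f t - (f t * G t + F t * g t) =
  (F q - F t) * g t - (G t - G p) * f t by ring.
apply: le_trans (ler_normB _ _) _; rewrite !normrM.
by apply: lerD; rewrite ler_wpM2r // (primitive_on_dist pF, primitive_on_dist pG).
Qed.

Lemma primitive_on_of_sqr_increment (h k H : R -> R) p q : p <= q ->
  mu.-integrable `[p, q]%classic (EFin \o h) -> mu.-integrable `[p, q]%classic (EFin \o k) ->
  (forall t, 0 <= k t) ->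
  (forall x y, p <= x -> x <= y -> y <= q ->
    `|H y - H x - \int[mu]_(t in `[x, y]) h t| <= (\int[mu]_(t in `[x, y]) k t) ^+ 2) ->
  primitive_on p q h H.
Proof.
move=> pq ith itk k0 Hh; split=> // x y px xy yq.
have [_ IhE] := primitive_on_sub (primitive_on_integral ith) px yq.
have pIk := primitive_on_sub (primitive_on_integral itk) px yq; have [_ IkE] := pIk.
have : H y - \int[mu]_(t in `[p, y]) h t = H x - \int[mu]_(t in `[p, x]) h t.
  apply: (@sqr_increment_cst _ (fun t => H t - \int[mu]_(s in `[p, t]) h s) _ _ _ xy
    (primitive_on_continuous pIk)) => [s t|s t xs st ty].
    rewrite !in_itv /= => /andP[xs _] /andP[_ ty] st.
    by rewrite -subr_ge0 IkE ?Rintegral_ge0.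
  rewrite IkE // (_ : _ - _ = H t - H s - \int[mu]_(r in `[s, t]) h r).
    by apply: Hh; [exact: le_trans xs|exact: st|exact: le_trans yq].
  by rewrite -(IhE s t) //; ring.
by rewrite -(IhE x y) // => ?; lra.
Qed.

Lemma primitive_onM f F g G p q : p <= q -> primitive_on p q f F -> primitive_on p q g G ->
  primitive_on p q (fun t => f t * G t + F t * g t) (fun t => F t * G t).
Proof.
move=> pq pF pG; have [itf _] := pF; have [itg _] := pG.
apply: (@primitive_on_of_sqr_increment _ (fun t => `|f t| + `|g t|)) => //.
- apply: integrable_addf => //; first exact: integrable_mul_continuous (primitive_on_continuous pG).
  rewrite (_ : (fun t => F t * g t) = (fun t => g t * F t)).
    exact: integrable_mul_continuous itg (primitive_on_continuous pF).
  by apply/funext => t; rewrite mulrC.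
- by apply: integrable_addf => //; exact: integrable_norm.
- move=> x y px xy yq; apply: primitive_mul_increment => //.
  + exact: primitive_on_sub pF px yq.
  + exact: primitive_on_sub pG px yq.
Qed.

Lemma MVT_between (phi dphi : R -> R) (a b x y : R) :
  (forall z, a <= z <= b -> is_derive z (1 : R) phi (dphi z)) ->
  a <= x <= b -> a <= y <= b ->
  exists2 z, Num.min x y <= z <= Num.max x y & phi y - phi x = dphi z * (y - x).
Proof.
move=> dph.
wlog xy : x y / x <= y => [IH|] axb ayb.
  have /orP[xy|yx] := le_total x y; first exact: IH.
  have [z] := IH y x yx ayb axb; rewrite minC maxC => yzx e; exists z => //.
  by rewrite -opprB e; ring.
have dxy z : z \in `[x, y] -> is_derive z (1 : R) phi (dphi z).
  by rewrite in_itv /= => /andP[xz zy]; apply: dph; apply/andP; split; lra.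
have cphi : {within `[x, y], continuous phi}.
  by apply: derivable_within_continuous => z /dxy [].
have [z] := MVT_segment xy (fun z zxy => dxy z (subset_itv_oo_cc zxy)) cphi.
by rewrite in_itv /= => xzy e; exists z => //; rewrite min_l ?max_r.
Qed.

Lemma between_itv (a b x y z : R) : a <= x <= b -> a <= y <= b ->
  Num.min x y <= z <= Num.max x y -> a <= z <= b.
Proof.
move=> /andP[ax xb] /andP[ay yb] /andP[xz zy].
by rewrite (le_trans _ xz) ?le_min ?ax //= (le_trans zy) // ge_max xb.
Qed.

Lemma primitive_comp_increment (phi dphi : R -> R) (a b K : R) f F p q : 0 <= K ->
  p <= q -> primitive_on p q f F -> (forall t, p <= t <= q -> a <= F t <= b) ->
  (forall z, a <= z <= b -> is_derive z (1 : R) phi (dphi z)) ->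
  (forall x y, a <= x <= b -> a <= y <= b -> `|dphi y - dphi x| <= K * `|y - x|) ->
  mu.-integrable `[p, q]%classic (EFin \o (fun t => f t * dphi (F t))) ->
  `|phi (F q) - phi (F p) - \int[mu]_(t in `[p, q]) (f t * dphi (F t))| <=
  (\int[mu]_(t in `[p, q]) ((K + 1) * `|f t|)) ^+ 2.
Proof.
move=> K0 pq pF Fab dph Kdph itfd; have [itf FE] := pF.
have itnf : mu.-integrable `[p, q]%classic (EFin \o (fun t => `|f t|)) by exact: integrable_norm.
have Fp := Fab p ltac:(by rewrite lexx); have Fq := Fab q ltac:(by rewrite pq lexx).
have [z zF ->] := MVT_between dph Fp Fq.
set A := \int[mu]_(t in `[p, q]) `|f t|.
have zab := between_itv Fp Fq zF.
have zFt t : p <= t <= q -> `|z - F t| <= A.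
  move=> /andP[pt tq]; have dp := primitive_on_dist pF (lexx p) pt tq.
  have dq := primitive_on_dist pF pt tq (lexx q).
  rewrite ler_distl; apply: (between_itv _ _ zF); rewrite -ler_distl //.
  by rewrite distrC.
rewrite RintegralZl // exprMn FE // -RintegralZl // -RintegralB //; last exact: integrable_scalef.
have itd : mu.-integrable `[p, q]%classic (EFin \o (fun t => dphi z * f t - f t * dphi (F t))).
  exact: (@integrableB _ _ _ mu _ _ _ _ (integrable_scalef (dphi z) _ itf) itfd).
apply: le_trans (le_normr_Rintegral _ itd) _ => //.
apply: (@le_trans _ _ (K * A * A)).
  rewrite /A -RintegralZl //; apply: le_Rintegral => //.
  - exact: integrable_norm.
  - exact: integrable_scalef.
  move=> t; rewrite /= in_itv /= => tpq.
  have -> : dphi z * f t - f t * dphi (F t) = (dphi z - dphi (F t)) * f t by ring.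
  rewrite normrM ler_wpM2r //; apply: le_trans (Kdph _ _ (Fab t tpq) zab) _.
  by rewrite ler_wpM2l // zFt.
rewrite -/A -mulrA -expr2 ler_wpM2r ?sqr_ge0 //.
by have := sqr_ge0 K; lra.
Qed.

Lemma primitive_on_comp (phi dphi d2phi : R -> R) (a b : R) f F p q :
  p <= q -> primitive_on p q f F -> (forall t, p <= t <= q -> a <= F t <= b) ->
  (forall z, a <= z <= b -> is_derive z (1 : R) phi (dphi z)) ->
  (forall z, a <= z <= b -> is_derive z (1 : R) dphi (d2phi z)) ->
  {within `[a, b], continuous d2phi} ->
  primitive_on p q (fun t => f t * dphi (F t)) (fun t => phi (F t)).
Proof.
move=> pq pF Fab dph d2ph cd2; have [itf _] := pF.
have [K K0 Kd2] : exists2 K, 0 <= K & forall z, a <= z <= b -> `|d2phi z| <= K.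
  have /compact_bounded[M [_ Mb]] := continuous_compact cd2 (@segment_compact _ a b).
  exists (`|M| + 1) => [|z zab]; first by rewrite addr_ge0.
  by apply: (Mb (`|M| + 1)); [rewrite ltr_pwDr ?ler_norm|exists z; rewrite //= in_itv].
have Kdph x y : a <= x <= b -> a <= y <= b -> `|dphi y - dphi x| <= K * `|y - x|.
  move=> xab yab; have [z zxy ->] := MVT_between d2ph xab yab.
  by rewrite normrM ler_wpM2r // Kd2 // (between_itv xab yab zxy).
have cdF : {within `[p, q], continuous (fun t => dphi (F t))}.
  apply/subspace_continuousP => t; rewrite /= in_itv /= => tpq.
  have /subspace_continuousP/(_ t) cF := primitive_on_continuous pF.
  have [/derivable1_diffP/differentiable_continuous cdphi _] := d2ph _ (Fab t tpq).
  by apply: (cvg_comp _ _ (cF _)) cdphi; rewrite /= in_itv.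
have itfd := integrable_mul_continuous itf cdF.
apply: (@primitive_on_of_sqr_increment _ (fun t => (K + 1) * `|f t|)) => //.
- by apply: integrable_scalef => //; exact: integrable_norm.
- by move=> t; rewrite mulr_ge0 ?addr_ge0.
move=> x y px xy yq; apply: (@primitive_comp_increment _ _ a b) => //.
- exact: primitive_on_sub pF px yq.
- by move=> t /andP[xt ty]; apply: Fab; rewrite (le_trans px) // (le_trans ty).
- exact: integrable_sub_seg itfd px yq.
Qed.

End Primitive.

(** * H1 functions on an interval *)

Section NonnegIntegral.
Context {R : realType}.
Local Notation mu := (@lebesgue_measure R).
Implicit Types (f : R -> R) (D : set R) (p q x : R).

Lemma continuous_Rintegral_gt0 f p q x : p < q -> {within `[p, q], continuous f} ->
  (forall t, 0 <= f t) -> p <= x <= q -> 0 < f x -> 0 < \int[mu]_(t in `[p, q]) f t.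
Proof.
move=> pq cf f0 /andP[px xq] fx.
have itf := continuous_seg_integrable cf.
have /cvgr_ge/(_ (f x / 2)) : f t @[t --> within `[p, q] (nbhs x)] --> f x.
  by move/subspace_continuousP : cf; apply; rewrite /= in_itv /= px xq.
move=> /(_ ltac:(lra)) [d /= d0 near_x].
pose x1 := Num.max p (x - d / 2); pose x2 := Num.min q (x + d / 2).
have px1 : p <= x1 by rewrite le_max lexx.
have x2q : x2 <= q by rewrite ge_min lexx.
have x12 : x1 < x2 by rewrite gt_max !lt_min pq /=; apply/and3P; split; lra.
have fge t : x1 <= t <= x2 -> f x / 2 <= f t.
  rewrite ge_max le_min => /andP[/andP[pt xt] /andP[tq tx]].
  by apply: near_x; rewrite /= ?in_itv /= ?pt //= ltr_norml; apply/andP; split; lra.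
have le12 : \int[mu]_(t in `[x1, x2]) f t <= \int[mu]_(t in `[p, q]) f t.
  by apply: ge0_subset_Rintegral => //; apply: subset_itv; rewrite bnd_simp.
apply: lt_le_trans le12.
apply: (@lt_le_trans _ _ (f x / 2 * (x2 - x1))).
  by rewrite mulr_gt0 ?subr_gt0 ?divr_gt0.
rewrite -(Rintegral_cst_seg _ (ltW x12)).
apply: le_Rintegral => //; first exact: integrable_cst_seg.
exact: integrable_sub_seg itf px1 x2q.
Qed.

Lemma Rintegral_itvcy_cvg f a : (forall t, 0 <= f t) ->
  mu.-integrable `[a, +oo[%classic (EFin \o f) ->
  \int[mu]_(t in `[a, x]) f t @[x --> +oo] --> \int[mu]_(t in `[a, +oo[) f t.
Proof.
move=> f0 itf.
have its x : mu.-integrable `[a, x]%classic (EFin \o f).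
  by apply: integrableS itf => //; exact: subset_itvl.
have cvgn : \int[mu]_(t in `[a, a + n%:R]) f t @[n --> \oo] --> \int[mu]_(t in `[a, +oo[) f t.
  apply: fine_cvg; rewrite fineK; last exact: (@integrable_fin_num _ _ _ mu _ _ _ itf).
  rewrite itv_bndy_bigcup_BRight; apply: ge0_nondecreasing_set_cvg_integral => //.
  - move=> m n mn; rewrite subsetEset; apply: subset_itvl.
    by rewrite bnd_simp lerD2l ler_nat.
  - by move=> n; case/integrableP : (its (a + n%:R)).
  - by move=> n t _; rewrite lee_fin.
apply/cvgrPdist_le => e e0.
have /cvgrPdist_le /(_ e e0) [N _ /(_ N (leqnn N)) IN] := cvgn.
near=> x; have aNx : a + N%:R <= x by near: x; apply: nbhs_pinfty_ge; exact: num_real.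
have leN : \int[mu]_(t in `[a, a + N%:R]) f t <= \int[mu]_(t in `[a, x]) f t.
  by apply: ge0_subset_Rintegral => //; apply: subset_itvl; rewrite bnd_simp.
have lex : \int[mu]_(t in `[a, x]) f t <= \int[mu]_(t in `[a, +oo[) f t.
  by apply: ge0_subset_Rintegral => //; exact: subset_itvl.
rewrite ger0_norm ?subr_ge0 //; apply: le_trans IN; apply: le_trans (ler_norm _).
by rewrite lerD2l lerN2.
Unshelve. all: end_near.
Qed.

Lemma Rintegral_itvcy_tail_cvg0 f a : (forall t, 0 <= f t) ->
  mu.-integrable `[a, +oo[%classic (EFin \o f) ->
  \int[mu]_(t in `[x, +oo[) f t @[x --> +oo] --> (0 : R).
Proof.
move=> f0 itf; rewrite -(subrr (\int[mu]_(t in `[a, +oo[) f t)).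
apply: (cvg_trans _ (cvgB (cvg_cst _) (Rintegral_itvcy_cvg f0 itf))).
apply: near_eq_cvg; near=> x.
have ax : a <= x by near: x; apply: nbhs_pinfty_ge; exact: num_real.
by rewrite fctE -(Rintegral_itv_cat itf ax isT) addrC addKr.
Unshelve. all: end_near.
Qed.

End NonnegIntegral.

Definition Lpow {R : realType} (n : nat) (D : set R) (f : R -> R) : R :=
  \int[lebesgue_measure]_(t in D) (f t ^+ n).

Section Lpow.
Context {R : realType}.
Local Notation mu := (@lebesgue_measure R).
Implicit Types (n : nat) (D E : set R) (f : R -> R) (a b : R) (c : itv_bound R).

Lemma Lpow_ge0 n D f : ~~ odd n -> 0 <= Lpow n D f.
Proof. by move=> evn; apply: Rintegral_ge0 => t _; exact: exprn_even_ge0. Qed.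

Lemma Lpow_subset n D E f : ~~ odd n -> measurable D -> measurable E -> E `<=` D ->
  mu.-integrable D (EFin \o (fun t => f t ^+ n)) -> Lpow n E f <= Lpow n D f.
Proof.
by move=> evn mD mE ED itf; apply: ge0_subset_Rintegral => // t; exact: exprn_even_ge0.
Qed.

Lemma Lpow_cat n f a b c :
  mu.-integrable [set` Interval (BLeft a) c] (EFin \o (fun t => f t ^+ n)) ->
  a <= b -> (BRight b <= c)%O ->
  Lpow n `[a, b] f + Lpow n [set` Interval (BLeft b) c] f =
  Lpow n [set` Interval (BLeft a) c] f.
Proof. exact: Rintegral_itv_cat. Qed.

Lemma Lpow_set1 n a f : Lpow n `[a, a] f = 0.
Proof. by rewrite /Lpow set_itv1 Rintegral_set1. Qed.

End Lpow.

Record H1_on {R : realType} (D : set R) (u du : R -> R) : Prop := H1On {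
  H1_measurable : measurable_fun D u ;
  H1_sqr_integrable : lebesgue_measure.-integrable D (EFin \o (fun t => u t ^+ 2)) ;
  H1_dsqr_integrable : lebesgue_measure.-integrable D (EFin \o (fun t => du t ^+ 2)) ;
  H1_primitive : forall p q, p <= q -> `[p, q]%classic `<=` D -> primitive_on p q du u }.

Section H1Interval.
Context {R : realType}.
Local Notation mu := (@lebesgue_measure R).
Variables (D : set R) (u du : R -> R).
Hypotheses (itvD : is_interval D) (uH1 : H1_on D u du).
Implicit Types (E : set R) (p q x y : R) (n : nat).

Let mD : measurable D := is_interval_measurable itvD.

Lemma H1_onS E : measurable E -> E `<=` D -> H1_on E u du.
Proof.
move=> mE ED; split.
- exact: measurable_funS (H1_measurable uH1).
- exact: integrableS (H1_sqr_integrable uH1).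
- exact: integrableS (H1_dsqr_integrable uH1).
- by move=> p q pq pqE; apply: (H1_primitive uH1) => //; exact: subset_trans ED.
Qed.

Lemma is_interval_seg_sub p q : D p -> D q -> `[p, q]%classic `<=` D.
Proof. by move=> Dp Dq t; rewrite /= in_itv /=; exact: itvD. Qed.

Lemma H1_primitive_on p q : D p -> D q -> p <= q -> primitive_on p q du u.
Proof. by move=> Dp Dq pq; apply: (H1_primitive uH1) => //; exact: is_interval_seg_sub. Qed.

Lemma H1_continuous p q : D p -> D q -> {within `[p, q], continuous u}.
Proof.
move=> Dp Dq; have [pq|qp] := leP p q.
  exact: primitive_on_continuous (H1_primitive_on Dp Dq pq).
by rewrite set_itv_ge ?bnd_simp -?ltNge //; exact: continuous_subspace0.
Qed.

Let it_energy : mu.-integrable D (EFin \o (fun t => u t ^+ 2 + du t ^+ 2)).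
Proof. exact: integrable_addf (H1_sqr_integrable uH1) (H1_dsqr_integrable uH1). Qed.

Lemma H1_sqr_dist p q : D p -> D q -> p <= q ->
  `|u q ^+ 2 - u p ^+ 2| <= Lpow 2 `[p, q] u + Lpow 2 `[p, q] du.
Proof.
move=> Dp Dq pq; have pqD := is_interval_seg_sub Dp Dq.
have pu := H1_primitive_on Dp Dq pq.
have [itd ->] := primitive_onM pq pu pu => //.
have H1pq := H1_onS (measurable_itv _) pqD.
rewrite /Lpow -RintegralD //; [|exact: H1_sqr_integrable H1pq|exact: H1_dsqr_integrable H1pq].
apply: le_trans (le_normr_Rintegral _ itd) _ => //.
apply: le_Rintegral => //; first exact: integrable_norm.
  exact: integrableS it_energy.
move=> t _; have := sqr_ge0 (u t - du t); have := sqr_ge0 (u t + du t).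
by rewrite ler_norml => ? ?; apply/andP; split; lra.
Qed.

Lemma H1_sqr_le x y : D x -> D y -> u x ^+ 2 <= u y ^+ 2 + (Lpow 2 D u + Lpow 2 D du).
Proof.
have sub p q : D p -> D q ->
    Lpow 2 `[p, q] u + Lpow 2 `[p, q] du <= Lpow 2 D u + Lpow 2 D du.
  move=> Dp Dq; have pqD := is_interval_seg_sub Dp Dq.
  apply: lerD; apply: Lpow_subset => //; first exact: H1_sqr_integrable uH1.
  exact: H1_dsqr_integrable uH1.
move=> Dx Dy; rewrite -lerBlDl; apply: le_trans (ler_norm _) _.
have [xy|/ltW yx] := leP x y.
  by rewrite distrC; apply: le_trans (H1_sqr_dist Dx Dy xy) (sub _ _ Dx Dy).
exact: le_trans (H1_sqr_dist Dy Dx yx) (sub _ _ Dy Dx).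
Qed.

Lemma H1_bounded : exists2 M, 0 <= M & forall x, D x -> `|u x| <= M.
Proof.
have [[y Dy]|noD] := pselect (exists y, D y); last first.
  by exists 0 => // x Dx; case: noD; exists x.
exists (Num.sqrt (u y ^+ 2 + (Lpow 2 D u + Lpow 2 D du))) => [|x Dx]; first exact: sqrtr_ge0.
by rewrite -sqrtr_sqr ler_wsqrtr // H1_sqr_le.
Qed.

Lemma H1_pow_integrable n : mu.-integrable D (EFin \o (fun t => u t ^+ n.+2)).
Proof.
have [M M0 uM] := H1_bounded.
have it2 := integrable_scalef (M ^+ n) mD (H1_sqr_integrable uH1).
apply: le_integrable it2 => //.
  by apply/measurable_EFinP; apply: measurable_funX; exact: H1_measurable uH1.
move=> t Dt /=; rewrite lee_fin -addn2 exprD !normrM ler_wpM2r // !normrX.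
by rewrite lerXn2r ?nnegrE // (ger0_norm M0) uM.
Qed.

Lemma Lpow_le n (M : R) : 0 <= M -> (forall x, D x -> `|u x| <= M) ->
  Lpow (n + 2) D u <= M ^+ n * Lpow 2 D u.
Proof.
move=> M0 uM; rewrite /Lpow -RintegralZl //; last exact: H1_sqr_integrable uH1.
apply: le_Rintegral => //; first by rewrite addn2; exact: H1_pow_integrable.
  exact: integrable_scalef (H1_sqr_integrable uH1).
move=> x Dx; rewrite exprD ler_wpM2r ?sqr_ge0 //; apply: le_trans (ler_norm _) _.
by rewrite normrX lerXn2r ?nnegrE // uM.
Qed.

End H1Interval.

Section H1Positive.
Context {R : realType}.
Variables (D : set R) (u du : R -> R).
Hypotheses (itvD : is_interval D) (uH1 : H1_on D u du).
Implicit Types (p q x : R) (n : nat).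

Lemma Lpow_seg_le p q n : ~~ odd n -> D p -> D q -> Lpow n.+2 `[p, q] u <= Lpow n.+2 D u.
Proof.
move=> evn Dp Dq; apply: Lpow_subset; rewrite /= ?negbK //.
- exact: is_interval_measurable.
- exact: is_interval_seg_sub.
- exact: (H1_pow_integrable itvD uH1).
Qed.

Lemma Lpow_seg_gt0 p q x n : ~~ odd n -> p < q -> D p -> D q -> p <= x <= q -> u x != 0 ->
  0 < Lpow n.+2 `[p, q] u.
Proof.
move=> evn pq Dp Dq xpq ux.
have ev_ge0 (t : R) : 0 <= t ^+ n.+2 by rewrite exprn_even_ge0 //= negbK.
apply: (continuous_Rintegral_gt0 pq _ _ xpq) => //; last first.
  by rewrite lt_def ev_ge0 expf_neq0.
apply/subspace_continuousP => t At.
have /subspace_continuousP/(_ t At) cut := H1_continuous itvD uH1 Dp Dq.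
exact: cvg_comp cut (@exprn_continuous _ _ _).
Qed.

Lemma Lpow2_seg_eq0 p q x : p < q -> D p -> D q -> Lpow 2 `[p, q] u = 0 -> p <= x <= q ->
  u x = 0.
Proof.
move=> pq Dp Dq I0 xpq; apply/eqP; apply: contraT => ux.
by have := @Lpow_seg_gt0 p q x 0 isT pq Dp Dq xpq ux; rewrite I0 ltxx.
Qed.

Lemma Lpow2_seg_le p q (r : R) : D p -> D q -> p <= q ->
  (forall t, p <= t <= q -> u t ^+ 2 <= r) -> Lpow 2 `[p, q] u <= r * (q - p).
Proof.
move=> Dp Dq pq ur; rewrite -Rintegral_cst_seg //; apply: le_Rintegral => //.
- have H1pq := H1_onS itvD uH1 (measurable_itv _) (is_interval_seg_sub itvD Dp Dq).
  exact: H1_sqr_integrable H1pq.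
- exact: integrable_cst_seg.
Qed.

End H1Positive.

Section H1Halfline.
Context {R : realType}.
Variables (a : R) (u du : R -> R).
Hypothesis uH1 : H1_on `[a, +oo[ u du.

Let itvD : is_interval `[a, +oo[%classic := @interval_is_interval _ _.

Lemma H1_sqr_le_tail x : a <= x ->
  u x ^+ 2 <= 2 * (Lpow 2 `[x, +oo[ u + Lpow 2 `[x, +oo[ du).
Proof.
move=> ax; set N := Lpow 2 `[x, +oo[ u + _.
have xS : `[x, +oo[%classic `<=` `[a, +oo[%classic by apply: subset_itvr; rewrite bnd_simp.
have itvx := @interval_is_interval R `[x, +oo[.
have H1x := H1_onS itvD uH1 (measurable_itv _) xS.
have inx t : x <= t -> `[x, +oo[%classic t by move=> xt; rewrite /= in_itv /= xt.
have x1 : x <= x + 1 by rewrite lerDl.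
have le_avg : (u x ^+ 2 - N) * (x + 1 - x) <= Lpow 2 `[x, x + 1] u.
  rewrite -Rintegral_cst_seg //; apply: le_Rintegral => //.
  - exact: integrable_cst_seg.
  - apply: integrableS (H1_sqr_integrable H1x) => //; exact: subset_itvl.
  move=> t; rewrite /= in_itv /= => /andP[xt _].
  by rewrite lerBlDr; exact: (H1_sqr_le itvx H1x (inx x (lexx x)) (inx t xt)).
have leS : Lpow 2 `[x, x + 1] u <= Lpow 2 `[x, +oo[ u.
  exact: (Lpow_seg_le itvx H1x (isT : ~~ odd 0) (inx _ (lexx x)) (inx _ x1)).
have := @Lpow_ge0 R 2 `[x, +oo[ du isT.
by move: le_avg; rewrite (_ : x + 1 - x = 1) /N; [lra|ring].
Qed.

Lemma H1_cvg_pinfty : u x @[x --> +oo] --> (0 : R).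
Proof.
have tail0 : 2 * (Lpow 2 `[x, +oo[ u + Lpow 2 `[x, +oo[ du) @[x --> +oo] --> (0 : R).
  rewrite (_ : 0 = 2 * (0 + 0)); last by rewrite addr0 mulr0.
  apply: cvgM; first exact: cvg_cst.
  apply: cvgD; apply: (@Rintegral_itvcy_tail_cvg0 _ _ a) => [t|]; rewrite ?sqr_ge0 //.
    exact: H1_sqr_integrable uH1.
  exact: H1_dsqr_integrable uH1.
apply/cvgrPdist_le => e e0.
have /cvgrPdist_le/(_ (e ^+ 2)) := tail0; rewrite exprn_gt0 // => /(_ isT) small.
near=> x; rewrite sub0r normrN.
have ax : a <= x by near: x; apply: nbhs_pinfty_ge; exact: num_real.
rewrite -(@ler_pXn2r _ 2) ?nnegrE ?(ltW e0) // real_normK ?num_real //.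
apply: le_trans (H1_sqr_le_tail ax) _; apply: le_trans (ler_norm _) _.
by rewrite -normrN -sub0r; near: x.
Unshelve. all: end_near.
Qed.

End H1Halfline.

(** * The calibration inequality *)

Section Tangent.
Context {R : realType}.
Implicit Types (x y c A B : R).

Let cos_neq0 x : - (pi / 2) < x < pi / 2 -> cos x != 0.
Proof. by move=> /cos_gt0_pihalf /lt0r_neq0. Qed.

Lemma is_derive_tan_sqr x : - (pi / 2) < x < pi / 2 ->
  is_derive x (1 : R) tan (1 + tan x ^+ 2).
Proof. by move=> hx; rewrite -cos2_tan2 ?cos_neq0 //; exact: is_derive_tan (cos_neq0 hx). Qed.

Lemma is_derive_1Dtan2 x : - (pi / 2) < x < pi / 2 ->
  is_derive x (1 : R) (fun t => 1 + tan t ^+ 2) (2 * tan x * (1 + tan x ^+ 2)).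
Proof.
move=> hx; have dt := is_derive_tan_sqr hx.
by apply: is_derive_eq; rewrite /GRing.scale /=; ring.
Qed.

Lemma le_tan x y : - (pi / 2) < x -> x <= y -> y < pi / 2 -> tan x <= tan y.
Proof.
move=> xl; rewrite le_eqVlt => /predU1P[->//|xy] yu.
by rewrite ltW // ltr_tan // in_itv /= ?yu ?xl ?(lt_trans xl xy) ?(lt_trans xy yu).
Qed.

Lemma tan_gt0 x : 0 < x < pi / 2 -> 0 < tan x.
Proof.
move=> /andP[x0 x1].
by rewrite -(@tan0 R) ltr_tan // in_itv /=; apply/andP; split; lra.
Qed.

Lemma ltr_id_tan x : 0 < x < pi / 2 -> x < tan x.
Proof.
move=> /andP[x0 x1].
have dt y : y \in `]0, x[ -> is_derive y (1 : R) tan (1 + tan y ^+ 2).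
  by rewrite in_itv /= => /andP[? ?]; apply: is_derive_tan_sqr; apply/andP; split; lra.
have ct : {within `[0, x], continuous (@tan R)}.
  apply: derivable_within_continuous => y; rewrite in_itv /= => /andP[? ?].
  by apply: derivable_tan; apply: cos_neq0; apply/andP; split; lra.
have [z] := MVT x0 dt ct; rewrite in_itv /= tan0 !subr0 => /andP[z0 zx] ->.
rewrite mulrDl mul1r ltrDl mulr_gt0 // exprn_gt0 // tan_gt0 //.
by apply/andP; split; lra.
Qed.

Lemma ler_id_tan x : 0 <= x < pi / 2 -> x <= tan x.
Proof.
move=> /andP[]; rewrite le_eqVlt => /predU1P[<- _|x0 x1]; first by rewrite tan0.
by rewrite ltW // ltr_id_tan // x0.
Qed.

Lemma ler_tan_left_limit A B c : - (pi / 2) < c < pi / 2 ->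
  (forall x, - (pi / 2) < x < c -> A * tan x <= B) -> A * tan c <= B.
Proof.
move=> hc AB; have ct : A * tan x @[x --> c^'-] --> A * tan c.
  apply: cvgM; first exact: cvg_cst.
  exact: cvg_at_left_filter (continuous_tan (cos_neq0 hc)).
apply: (cvgr_to_le ct); near=> x; apply: AB; apply/andP; split.
  by near: x; apply: nbhs_left_gt; case/andP: hc.
by near: x; exact: nbhs_left_lt.
Unshelve. all: end_near.
Qed.

Lemma ler_sin_id x : 0 <= x -> sin x <= x.
Proof.
rewrite le_eqVlt => /predU1P[<-|x0]; first by rewrite sin0.
have [z _] := MVT x0 (fun y _ => is_derive_sin y) (continuous_subspaceT (@continuous_sin R)).
by rewrite sin0 !subr0 => ->; rewrite ler_piMl ?cos_le1 // ltW.
Qed.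

Lemma cotB_double x : 0 < x < pi / 2 ->
  tan (pi / 2 - x) - tan (pi / 2 - 2 * x) = (2 * (sin x * cos x))^-1.
Proof.
move=> /andP[x0 x1].
have s0 : sin x != 0 by apply: lt0r_neq0; apply: sin_gt0_pi; apply/andP; split; lra.
have c0 : cos x != 0 by apply: cos_neq0; apply/andP; split; lra.
rewrite /tan !sinB !cosB sin_pihalf cos_pihalf !mul0r !mul1r !subr0 !add0r.
by rewrite mulr_natl sin_mulr2n cos_mulr2n; field; rewrite s0 c0.
Qed.

End Tangent.

(* A piece of a graph carrying mass [m], kinetic term [q] and sextic term [w], with end
   values [U] and [V] of the function; [V = 0] for a piece reaching infinity. *)
Definition calibrated (R : realType) (b U V m q w : R) : Prop := 0 <= m /\
  forall c, - (pi / 2) < c -> c + 2 * b * m < pi / 2 ->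
  b / 2 * (U ^+ 4 * tan c - V ^+ 4 * tan (c + 2 * b * m)) <= q - b ^+ 2 * w.

Section H1Calibration.
Context {R : realType}.
Local Notation mu := (@lebesgue_measure R).
Variables (D : set R) (u du : R -> R).
Hypotheses (itvD : is_interval D) (uH1 : H1_on D u du).
Implicit Types (p q b c : R).

Lemma primitive_on_tan_mass p q b c : 0 <= b -> D p -> D q -> p <= q ->
  - (pi / 2) < c -> c + 2 * b * Lpow 2 `[p, q] u < pi / 2 ->
  let theta x := c + 2 * b * Lpow 2 `[p, x] u in
  primitive_on p q (fun t => 2 * b * u t ^+ 2 * (1 + tan (theta t) ^+ 2))
    (fun t => tan (theta t)).
Proof.
move=> b0 Dp Dq pq cl cu theta; set m := Lpow 2 `[p, q] u in cu.
have H1pq := H1_onS itvD uH1 (measurable_itv _) (is_interval_seg_sub itvD Dp Dq).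
have itX := H1_pow_integrable (@interval_is_interval _ _) H1pq.
have ptheta := primitive_on_affine c (2 * b) (primitive_on_integral (itX 0%N)).
have thetaE x : p <= x <= q -> c <= theta x <= c + 2 * b * m.
  move=> /andP[px xq]; rewrite lerDl lerD2l mulr_ge0 ?mulr_ge0 ?Lpow_ge0 //=.
  rewrite ler_wpM2l ?mulr_ge0 //; apply: Lpow_subset => //.
  by apply: subset_itvl; rewrite bnd_simp.
have theta_in z : c <= z <= c + 2 * b * m -> - (pi / 2) < z < pi / 2.
  by move=> /andP[cz zm]; rewrite (lt_le_trans cl cz) (le_lt_trans zm cu).
apply: (@primitive_on_comp _ tan (fun z => 1 + tan z ^+ 2)
  (fun z => 2 * tan z * (1 + tan z ^+ 2)) c (c + 2 * b * m) _ _ _ _ pq ptheta thetaE)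
  => [z /theta_in|z /theta_in|]; [exact: is_derive_tan_sqr|exact: is_derive_1Dtan2|].
apply: derivable_within_continuous => z; rewrite in_itv => /theta_in hz.
have dt := is_derive_tan_sqr hz; exact: ex_derive.
Qed.

(* Completing the square in [u' + b * tan (c + 2 b S) * u ^ 3] with [S] the mass
   accumulated from [p]: since [S' = u ^ 2] and [tan' = 1 + tan ^ 2], the cross term is the
   derivative of [b * u ^ 4 * tan (c + 2 b S) / 2] up to a multiple of [u ^ 6]. *)
Lemma calibrated_seg p q b : 0 <= b -> D p -> D q -> p <= q ->
  calibrated b (u p) (u q) (Lpow 2 `[p, q] u) (Lpow 2 `[p, q] du) (Lpow 6 `[p, q] u).
Proof.
move=> b0 Dp Dq pq; split=> [|c cl cu]; first exact: Lpow_ge0.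
have H1pq := H1_onS itvD uH1 (measurable_itv _) (is_interval_seg_sub itvD Dp Dq).
have it_u6 := H1_pow_integrable (@interval_is_interval _ _) H1pq 4.
have it_du2 := H1_dsqr_integrable H1pq.
have ptan := primitive_on_tan_mass b0 Dp Dq pq cl cu.
set theta := fun x => c + 2 * b * Lpow 2 `[p, x] u in ptan.
have thetap : theta p = c by rewrite /theta Lpow_set1 mulr0 addr0.
have pu := H1_primitive_on itvD uH1 Dp Dq pq; have pu2 := primitive_onM pq pu pu.
have [itg gE] := primitive_onM pq (primitive_onM pq pu2 pu2) ptan.
have {gE} := gE p q (lexx p) pq (lexx q); rewrite thetap -/(theta q).
set g := (X in Rintegral _ _ X) => gE.
have -> : b / 2 * (u p ^+ 4 * tan c - u q ^+ 4 * tan (theta q)) =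
    - (b / 2 * \int[mu]_(t in `[p, q]) g t) by rewrite -gE; ring.
have itbg := integrable_scalef (b / 2) (measurable_itv _) itg.
rewrite lerBrDr addrC lerBlDr /Lpow -(RintegralZl _ _ it_u6) //.
rewrite -(RintegralZl _ _ itg) // -RintegralD //.
apply: le_Rintegral => //; [exact: integrable_scalef it_u6|exact: integrable_addf|].
move=> t _; rewrite -subr_ge0.
rewrite (_ : _ - _ = (du t + b * tan (theta t) * u t ^+ 3) ^+ 2) ?sqr_ge0 //.
by rewrite /g; field.
Qed.

End H1Calibration.

Lemma calibrated_halfline (R : realType) (p b : R) (u du : R -> R) : 0 <= b ->
  H1_on `[p, +oo[ u du ->
  calibrated b (u p) 0 (Lpow 2 `[p, +oo[ u) (Lpow 2 `[p, +oo[ du) (Lpow 6 `[p, +oo[ u).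
Proof.
move=> b0 uH1; have itvy := @interval_is_interval R `[p, +oo[.
have iny x : p <= x -> `[p, +oo[%classic x by move=> px; rewrite /= in_itv /= px.
split=> [|c cl cu]; first exact: Lpow_ge0.
rewrite expr0n mul0r subr0; set m := Lpow 2 `[p, +oo[ u in cu.
set T := tan (c + 2 * b * m).
have T_ge0 x : p <= x -> u x ^+ 4 * tan (c + 2 * b * Lpow 2 `[p, x] u) <= u x ^+ 4 * T.
  move=> px; have S0 : 0 <= Lpow 2 `[p, x] u by exact: Lpow_ge0.
  have Sm := Lpow_seg_le itvy uH1 (isT : ~~ odd 0) (iny p (lexx p)) (iny x px).
  have bS0 : 0 <= 2 * b * Lpow 2 `[p, x] u by rewrite !mulr_ge0.
  have bSm : 2 * b * Lpow 2 `[p, x] u <= 2 * b * m by rewrite ler_wpM2l ?mulr_ge0.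
  by rewrite ler_wpM2l ?exprn_even_ge0 // le_tan //; lra.
have cvg_rhs : Lpow 2 `[p, +oo[ du - b ^+ 2 * Lpow 6 `[p, x] u + b / 2 * (u x ^+ 4 * T)
    @[x --> +oo] --> Lpow 2 `[p, +oo[ du - b ^+ 2 * Lpow 6 `[p, +oo[ u + b / 2 * (0 ^+ 4 * T).
  apply: cvgD.
    apply: cvgB; first exact: cvg_cst.
    apply: cvgM; first exact: cvg_cst.
    apply: Rintegral_itvcy_cvg => [t|]; first exact: exprn_even_ge0.
    exact: (H1_pow_integrable itvy uH1 4).
  apply: cvgM; first exact: cvg_cst.
  apply: cvgM; last exact: cvg_cst.
  exact: (cvg_comp _ _ (H1_cvg_pinfty uH1) (@exprn_continuous R 4 0)).
have {cvg_rhs} := cvg_rhs; rewrite expr0n mul0r mulr0 addr0 => /cvgr_to_ge; apply.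
near=> x; have px : p <= x by near: x; apply: nbhs_pinfty_ge; exact: num_real.
have S0 : 0 <= Lpow 2 `[p, x] u by exact: Lpow_ge0.
have Sm := Lpow_seg_le itvy uH1 (isT : ~~ odd 0) (iny p (lexx p)) (iny x px).
have bSm : 2 * b * Lpow 2 `[p, x] u <= 2 * b * m by rewrite ler_wpM2l ?mulr_ge0.
have [_ cal] := calibrated_seg itvy uH1 b0 (iny p (lexx p)) (iny x px) px.
have {cal} := cal c cl ltac:(lra); rewrite mulrBr lerBlDr => /le_trans; apply.
apply: lerD; last by rewrite ler_wpM2l ?T_ge0 // divr_ge0.
rewrite lerD2r; apply: Lpow_subset => //; first exact: subset_itvl.
exact: H1_dsqr_integrable uH1.
Unshelve. all: end_near.
Qed.

Section CalibratedTheory.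
Context {R : realType}.
Variable b : R.
Hypothesis b0 : 0 < b.
Implicit Types U V X m q w : R.

Lemma calibrated_nil U : calibrated b U U 0 0 0.
Proof. by split=> // c _ _; rewrite !mulr0 addr0 !subrr mulr0. Qed.

Lemma calibrated_sym U V m q w : calibrated b U V m q w -> calibrated b V U m q w.
Proof.
move=> [m0 cal]; split=> // c cl cu.
have := cal (- (c + 2 * b * m)) ltac:(lra) ltac:(lra).
rewrite (_ : - (c + 2 * b * m) + 2 * b * m = - c) ?tanN; last by ring.
by lra.
Qed.

Lemma calibrated_cat U V X m1 q1 w1 m2 q2 w2 :
  calibrated b U V m1 q1 w1 -> calibrated b V X m2 q2 w2 ->
  calibrated b U X (m1 + m2) (q1 + q2) (w1 + w2).
Proof.
move=> [m1_ge0 cal1] [m2_ge0 cal2]; split=> [|c cl cu]; first exact: addr_ge0.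
have bm1 : 0 <= 2 * b * m1 by rewrite !mulr_ge0 // ltW.
have bm2 : 0 <= 2 * b * m2 by rewrite !mulr_ge0 // ltW.
have := cal1 c cl ltac:(lra); have := cal2 (c + 2 * b * m1) ltac:(lra) ltac:(lra).
rewrite (_ : c + 2 * b * (m1 + m2) = c + 2 * b * m1 + 2 * b * m2); last by ring.
by lra.
Qed.

Lemma calibrated0_le U m q w c : calibrated b U 0 m q w ->
  - (pi / 2) < c < pi / 2 -> c + 2 * b * m <= pi / 2 ->
  b / 2 * (U ^+ 4 * tan c) <= q - b ^+ 2 * w.
Proof.
move=> [m0 cal] hc cm; rewrite mulrA; apply: ler_tan_left_limit => // x /andP[xl xc].
by have := cal x xl ltac:(lra); rewrite expr0n mul0r subr0 mulrA.
Qed.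

(* [mr] is the mass off the calibrated piece, where [w] is at most [U ^ 4] times the mass. *)
Lemma calibrated_rest_le U mP qP wP mr q w : calibrated b U 0 mP qP wP ->
  0 < mP -> 0 <= mr -> 2 * b * (mP + mr) = pi / 2 -> qP <= q -> w <= wP + U ^+ 4 * mr ->
  b ^+ 2 * w <= q /\ (U != 0 -> q = b ^+ 2 * w -> mr = 0).
Proof.
move=> cal mP0 mr0 tot qq ww.
have bmP : 0 < 2 * b * mP by rewrite !mulr_gt0.
have bmr : 0 <= 2 * b * mr by rewrite !mulr_ge0 // ltW.
have hc : - (pi / 2) < 2 * b * mr < pi / 2 by apply/andP; split; lra.
have lower := calibrated0_le cal hc ltac:(lra).
have bw : b ^+ 2 * w <= b ^+ 2 * (wP + U ^+ 4 * mr) by rewrite ler_wpM2l ?sqr_ge0.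
have bU : 0 <= b / 2 * U ^+ 4 by rewrite mulr_ge0 ?exprn_even_ge0 // divr_ge0 // ltW.
split.
  have : b / 2 * U ^+ 4 * (2 * b * mr) <= b / 2 * U ^+ 4 * tan (2 * b * mr).
    by rewrite ler_wpM2l // ler_id_tan // bmr; case/andP: hc.
  by lra.
move=> Un0 qe; apply/eqP; rewrite eq_le mr0 andbT leNgt; apply/negP => mrp.
have : b / 2 * U ^+ 4 * (2 * b * mr) < b / 2 * U ^+ 4 * tan (2 * b * mr).
  have bU_gt0 : 0 < b / 2 * U ^+ 4 by rewrite mulr_gt0 ?divr_gt0 // exprn_even_gt0.
  by rewrite ltr_pM2l // ltr_id_tan // !mulr_gt0 //=; case/andP: hc.
by lra.
Qed.

Section EqualityCase.
Variables M U m1 q1 w1 s q2 w2 : R.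
Hypotheses (before : calibrated b M U m1 q1 w1) (after : calibrated b U 0 s q2 w2)
  (tot : 2 * b * (m1 + s) = pi / 2) (eqw : q1 + q2 = b ^+ 2 * (w1 + w2)) (s0 : 0 < s).

Lemma calibrated_eq_neq0 : M != 0 -> U != 0.
Proof.
move: tot => totE M0; apply/eqP => U0.
have [m1_ge0 cal1] := before; have [_ cal2] := after.
have bs : 0 < b * s by rewrite mulr_gt0.
have bm1 : 0 <= b * m1 by rewrite mulr_ge0 // ltW.
have := cal1 (b * s) ltac:(lra) ltac:(lra).
have := cal2 (- (b * s)) ltac:(lra) ltac:(lra).
have : 0 < b / 2 * (M ^+ 4 * tan (b * s)).
  apply: mulr_gt0; first by rewrite divr_gt0.
  apply: mulr_gt0; first by rewrite exprn_even_gt0.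
  by apply: tan_gt0; apply/andP; split; lra.
by move: eqw; rewrite U0 expr0n /= !mul0r; lra.
Qed.

(* For the optimiser [u ^ 2 = M ^ 2 * sin (2 b s)]. *)
Lemma calibrated_eq_sqr_le : `|U| <= `|M| -> U ^+ 2 <= 4 * b * M ^+ 2 * s.
Proof.
move: tot => totE; have [m1_ge0 cal1] := before; have p2 := pi_ge2 R.
rewrite -(@ler_pXn2r _ 2) ?nnegrE // !real_normK ?num_real // => UM.
set y := 2 * b * s; have y0 : 0 < y by rewrite !mulr_gt0.
rewrite (_ : 4 * b * M ^+ 2 * s = 2 * M ^+ 2 * y); last by rewrite /y; ring.
have M2_ge0 := sqr_ge0 M.
have [y1|y1] := leP (pi / 2) y.
  by apply: le_trans UM _; rewrite mulrAC ler_peMl //; lra.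
have angleE : - y + 2 * b * m1 = pi / 2 - 2 * y by rewrite -totE /y; ring.
have := cal1 (- y) ltac:(lra) ltac:(lra); rewrite angleE tanN => lower1.
have hc : - (pi / 2) < pi / 2 - y < pi / 2 by apply/andP; split; lra.
have := calibrated0_le after hc ltac:(rewrite -/y; lra) => lower2.
have hy : 0 < y < pi / 2 by rewrite y0.
have sy : 0 < sin y by apply: sin_gt0_pi; rewrite y0; lra.
have cy : 0 < cos y by apply: cos_gt0_pihalf; apply/andP; split; lra.
have : b / 2 * (U ^+ 4 * (tan (pi / 2 - y) - tan (pi / 2 - 2 * y)) - M ^+ 4 * tan y) <= 0.
  by move: eqw lower1 lower2; lra.
rewrite pmulr_rle0 ?divr_gt0 // subr_le0 cotB_double // ler_pdivrMr ?mulr_gt0 // => U4.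
have {}U4 : U ^+ 4 <= 2 * M ^+ 4 * sin y ^+ 2.
  suff <- : M ^+ 4 * tan y * (2 * (sin y * cos y)) = 2 * M ^+ 4 * sin y ^+ 2 by [].
  by rewrite /tan; field; rewrite lt0r_neq0.
have sin2 : M ^+ 4 * sin y ^+ 2 <= M ^+ 4 * y ^+ 2.
  by rewrite ler_wpM2l ?exprn_even_ge0 // ler_sqr ?nnegrE ?ler_sin_id ?ltW.
have M4y2 : 0 <= M ^+ 4 * y ^+ 2 by rewrite mulr_ge0 ?sqr_ge0 // exprn_even_ge0.
have My0 : 0 <= 2 * M ^+ 2 * y by rewrite mulr_ge0 ?(ltW y0) // mulr_ge0.
rewrite -(@ler_pXn2r _ 2) ?nnegrE ?sqr_ge0 // -exprM.
by rewrite (_ : (2 * M ^+ 2 * y) ^+ 2 = 4 * (M ^+ 4 * y ^+ 2)); [lra|ring].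
Qed.

End EqualityCase.
End CalibratedTheory.

(** * Paths to infinity *)

Section SimplePaths.
Context {R : realType}.
Variable G : graph R.
Implicit Types (e : 'I_(nE G)) (v w : 'I_(nV G)) (L : seq 'I_(nE G)).

Definition touches e v : bool := (src G e == v) || (bnd G e && (tgt G e == v)).

Definition joins e v w : bool :=
  bnd G e && ((src G e == v) && (tgt G e == w) || (src G e == w) && (tgt G e == v)).

Definition visits L v : bool := has (touches^~ v) L.

(* The edges [L], in this order, form a path without repeated vertices from [v] to
   infinity. *)
Inductive spath : 'I_(nV G) -> seq 'I_(nE G) -> Prop :=
| spath_half e : ~~ bnd G e -> spath (src G e) [:: e]
| spath_step e v w L : joins e v w -> spath w L -> ~~ visits L v -> spath v (e :: L).

Definition edge_deg e v : nat := (src G e == v) + (bnd G e && (tgt G e == v)).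

Lemma joins_sym e v w : joins e v w = joins e w v.
Proof. by rewrite /joins orbC. Qed.

Lemma joinsP e v w : reflect (bnd G e /\
    (src G e = v /\ tgt G e = w \/ src G e = w /\ tgt G e = v)) (joins e v w).
Proof.
apply: (iffP andP) => -[be].
  by case/orP=> /andP[/eqP sv /eqP tw]; split=> //; [left|right].
by case=> -[-> ->]; rewrite !eqxx ?orbT.
Qed.

Lemma touches_src e : touches e (src G e).
Proof. by rewrite /touches eqxx. Qed.

Lemma touches_tgt e : bnd G e -> touches e (tgt G e).
Proof. by move=> be; rewrite /touches be eqxx orbT. Qed.

Lemma touches_half e v : ~~ bnd G e -> touches e v = (v == src G e).
Proof. by move=> /negbTE be; rewrite /touches be orbF eq_sym. Qed.

Lemma touches_joins e v w x : joins e v w -> touches e x = (x == v) || (x == w).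
Proof.
rewrite /touches => /joinsP[-> [] [-> ->]]; first by rewrite eq_sym (eq_sym w).
by rewrite orbC eq_sym (eq_sym w).
Qed.

Lemma joins_touches e v w : joins e v w -> touches e v.
Proof. by move=> ej; rewrite (touches_joins _ ej) eqxx. Qed.

Lemma visits_touches L e v : e \in L -> touches e v -> visits L v.
Proof. by move=> eL ev; apply/hasP; exists e. Qed.

Lemma spath_visits v L : spath v L -> visits L v.
Proof.
case=> [e _|e {}v w {}L ej _ _]; apply: (@visits_touches _ e); rewrite ?mem_head //.
  exact: touches_src.
exact: joins_touches ej.
Qed.

Lemma spath_from_visited v w L : spath v L -> visits L w -> exists L', spath w L'.
Proof.
elim=> [e be|e {}v v' {}L ej pL IH nv] /=.
  by rewrite orbF touches_half // => /eqP ->; exists [:: e]; exact: spath_half.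
case/orP=> [|/IH //]; rewrite (touches_joins _ ej) => /orP[]/eqP ->.
  by exists (e :: L); exact: spath_step ej pL nv.
by exists L.
Qed.

Lemma spath_joins e v w L : joins e v w -> spath w L -> exists L', spath v L'.
Proof.
move=> ej pL; have [vL|vL] := boolP (visits L v); first exact: spath_from_visited pL vL.
by exists (e :: L); exact: spath_step ej pL vL.
Qed.

Lemma spath_exists v : connected_graph G -> noncompact G -> exists L, spath v L.
Proof.
move=> [_ conn] [e be]; have /connectP[p pp ep] := conn v (src G e).
elim: p v pp ep => [|w p IH] v /=; first by move=> _ <-; exists [:: e]; exact: spath_half.
move=> /andP[/existsP[e' ej] pp] ep.
by have [L pL] := IH w pp ep; exact: spath_joins ej pL.
Qed.

Lemma spath_uniq v L : spath v L -> uniq L.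
Proof.
elim=> // e {}v w {}L ej _ uL nv /=; rewrite uL andbT; apply: contra nv => eL.
exact: visits_touches eL (joins_touches ej).
Qed.

Lemma spath_avoid_first e v L : bnd G e -> spath v L -> src G e = v -> e \in L ->
  exists2 L', e \notin L' & spath (src G e) L' \/ spath (tgt G e) L'.
Proof.
move=> be [e' be' _|e' {}v w L' ej pL nv ev].
  by rewrite inE => /eqP ee; rewrite -ee be in be'.
have eL' : e \notin L'.
  by apply: contra nv => eL'; apply: visits_touches eL' _; rewrite -ev touches_src.
rewrite inE (negbTE eL') orbF => /eqP ee; exists L' => //.
by move: ej; rewrite -ee => /joinsP[_ [[_ ->]|[-> _]]]; [right|left].
Qed.

Lemma spath_avoid e : connected_graph G -> noncompact G -> bnd G e ->
  exists2 L, e \notin L & spath (src G e) L \/ spath (tgt G e) L.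
Proof.
move=> cG nG be; have [L pL] := spath_exists (src G e) cG nG.
have [eL|eL] := boolP (e \in L); last by exists L => //; left.
exact: spath_avoid_first pL _ eL.
Qed.

Lemma spath_deg v L w : spath v L ->
  (\sum_(e <- L) edge_deg e w)%N = if w == v then 1%N else if visits L w then 2%N else 0%N.
Proof.
elim=> [e be|e {}v v' {}L ej pL IH nv].
  by rewrite big_seq1 /visits /= orbF touches_half // /edge_deg (negbTE be) addn0 eq_sym; case: eqP.
have vv' : v != v' by apply: contraNneq nv => ->; exact: spath_visits pL.
have -> : visits (e :: L) w = [|| w == v, w == v' | visits L w].
  by rewrite /visits /= (touches_joins _ ej) orbA.
have deg_e : edge_deg e w = ((w == v) + (w == v'))%N.
  by rewrite /edge_deg; case/joinsP: ej => -> [] [-> ->] /=; rewrite ?(eq_sym w) // addnC.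
rewrite big_cons IH deg_e; have [->|wv] := eqVneq w v.
  by rewrite (negbTE vv') (negbTE nv).
by have [->|] := eqVneq w v'.
Qed.

Lemma spath_count_half v L : spath v L -> (\sum_(e <- L) (~~ bnd G e : nat))%N = 1%N.
Proof.
elim=> [e be|e {}v v' {}L /andP[be _] pL IH nv]; first by rewrite big_seq1 be.
by rewrite big_cons be IH.
Qed.

Lemma degreeE v : degree G v = (\sum_e edge_deg e v)%N.
Proof.
rewrite /degree big_split /=; congr (_ + _)%N; rewrite -sum1_card big_mkcond /=;
  apply: eq_bigr => e _; rewrite [_ \in _]asboolb.
  by case: (src G e == v).
by case: (bnd G e && _).
Qed.

Lemma card_halflines : #|[set e | ~~ bnd G e]| = (\sum_e (~~ bnd G e : nat))%N.
Proof.
rewrite -sum1_card big_mkcond /=; apply: eq_bigr => e _.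
by rewrite [_ \in _]asboolb; case: (bnd G e).
Qed.

Lemma sum_spath_all v L (F : 'I_(nE G) -> nat) : spath v L -> (forall e, e \in L) ->
  (\sum_e F e = \sum_(e <- L) F e)%N.
Proof.
move=> pL allL; rewrite -big_enum /=; apply: perm_big.
apply: uniq_perm; [exact: enum_uniq|exact: spath_uniq pL|].
by move=> e; rewrite mem_enum allL.
Qed.

Lemma spath_all_is_halfline v L : spath v L -> (forall e, e \in L) -> is_halfline G.
Proof.
move=> pL allL; split.
  by rewrite card_halflines (sum_spath_all _ pL allL) (spath_count_half pL).
move=> w; rewrite degreeE (sum_spath_all _ pL allL) (spath_deg w pL).
by case: ifP => //; case: ifP.
Qed.

Lemma spath_closed_all v L : connected_graph G -> spath v L ->
  (forall e w, visits L w -> touches e w -> e \in L) -> forall e, e \in L.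
Proof.
move=> [_ conn] pL closedL.
have along p w : path (adj G) w p -> visits L w -> visits L (last w p).
  elim: p w => [|x p IH] w //= /andP[/existsP[e ej] pp] wL; apply: IH => //.
  apply: (visits_touches (closedL e w wL (joins_touches ej))).
  by apply: (joins_touches (w := w)); rewrite joins_sym.
have visits_all w : visits L w.
  by have /connectP[p pp ->] := conn v w; exact: along pp (spath_visits pL).
by move=> e; apply: closedL (visits_all (src G e)) (touches_src e).
Qed.

Lemma edge_deg_gt0 e v : touches e v -> (0 < edge_deg e v)%N.
Proof. by rewrite /touches /edge_deg; case: (src G e == v) => //= ->. Qed.

Lemma spath_deg_le v L e w : spath v L -> e \notin L ->
  (\sum_(e' <- L) edge_deg e' w + edge_deg e w <= degree G w)%N.
Proof.
move=> pL eL; rewrite degreeE (bigD1 e) //= addnC leq_add2l.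
rewrite (big_uniq _ (spath_uniq pL)) /= big_mkcond [leqRHS]big_mkcond /=.
apply: leq_sum => e' _; case: ifP => // e'L.
by case: eqP => // ee; rewrite -ee e'L in eL.
Qed.

Lemma halfline_spath_all v L : connected_graph G -> is_halfline G -> degree G v = 1%N ->
  spath v L -> forall e, e \in L.
Proof.
move=> cG [_ deg2] dv pL; apply: (spath_closed_all cG pL) => e w wL ew.
apply: contraT => eL; have := spath_deg_le w pL eL; rewrite (spath_deg w pL) wL.
have := edge_deg_gt0 ew; case: eqP => [->|_] d0; first by rewrite dv; case: (edge_deg e v) d0.
by move=> /leq_trans /(_ (deg2 w)); case: (edge_deg e w) d0.
Qed.

Lemma degree1_edge_deg v e : degree G v = 1%N -> touches e v -> edge_deg e v = 1%N.
Proof.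
move=> dv /edge_deg_gt0 d0; move: dv; rewrite degreeE (bigD1 e) //=.
by case: (edge_deg e v) d0 => // n _; rewrite addSn => -[] /eqP; rewrite addn_eq0 => /andP[/eqP ->].
Qed.

Lemma degree1_touches v e e' : degree G v = 1%N -> touches e v -> touches e' v -> e' = e.
Proof.
move=> dv ev e'v; apply/eqP; apply: contraT => ee; move: dv.
rewrite degreeE (bigD1 e) //= (bigD1 e') //=.
case: (edge_deg e v) (edge_deg_gt0 ev) => // n _.
by case: (edge_deg e' v) (edge_deg_gt0 e'v) => // p _; rewrite !addSn addnS.
Qed.

Lemma degree1_halfline_all v e : connected_graph G -> degree G v = 1%N -> touches e v ->
  ~~ bnd G e -> spath v [:: e] /\ forall e', e' \in [:: e].
Proof.
move=> cG dv ev be; have /eqP vE : v == src G e by rewrite -touches_half.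
have pe : spath v [:: e] by rewrite vE; exact: spath_half.
split=> //; apply: (spath_closed_all cG pe) => e' w.
rewrite /visits /= orbF touches_half // -vE => /eqP -> e'v.
by rewrite (degree1_touches dv ev e'v) mem_head.
Qed.

End SimplePaths.

(** * The sharp inequality *)

Lemma gronwall_eq0 (R : realType) (s : R -> R) (p q C x0 x : R) : 0 <= C ->
  (forall t, p <= t <= q -> 0 <= s t) ->
  (forall y z, p <= y <= q -> p <= z <= q -> s y - s z <= C * s y * `|y - z|) ->
  p <= x0 <= q -> p <= x <= q -> s x0 = 0 -> s x = 0.
Proof.
move=> C0 s0 sC x0pq xpq sx0.
pose n := (Num.trunc (2 * (C * `|x - x0|))).+1.
have n0 : 0 < n%:R :> R by rewrite ltr0n.
have Cn : 2 * (C * `|x - x0|) <= n%:R by apply: ltW; exact: truncnS_gt.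
pose z (k : nat) : R := x0 + k%:R / n%:R * (x - x0).
have zpq k : (k <= n)%N -> p <= z k <= q.
  move=> kn; have t0 : 0 <= k%:R / n%:R :> R by rewrite divr_ge0.
  have t1 : 0 <= 1 - k%:R / n%:R :> R by rewrite subr_ge0 ler_pdivrMr // mul1r ler_nat.
  have -> : z k = (1 - k%:R / n%:R) * x0 + k%:R / n%:R * x by rewrite /z; ring.
  move: x0pq xpq => /andP[px0 x0q] /andP[px xq].
  have := ler_wpM2l t0 px; have := ler_wpM2l t0 xq.
  have := ler_wpM2l t1 px0; have := ler_wpM2l t1 x0q.
  by move=> *; apply/andP; split; lra.
have sz k : (k <= n)%N -> s (z k) = 0.
  elim: k => [_|k IHk kn]; first by rewrite /z mul0r mul0r addr0.
  have zk1 := zpq _ kn; have zk := zpq _ (ltnW kn).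
  have := sC _ _ zk1 zk; rewrite (IHk (ltnW kn)) subr0.
  have -> : z k.+1 - z k = (x - x0) / n%:R by rewrite /z -natr1; field; rewrite lt0r_neq0.
  rewrite normrM normfV (gtr0_norm n0) => sle.
  have s_ge0 := s0 _ zk1.
  have : C * s (z k.+1) * (`|x - x0| / n%:R) <= s (z k.+1) / 2.
    have -> : C * s (z k.+1) * (`|x - x0| / n%:R) =
        s (z k.+1) / 2 * (2 * (C * `|x - x0|) / n%:R) by field; rewrite lt0r_neq0.
    by rewrite ler_piMr ?divr_ge0 // ler_pdivrMr // mul1r.
  by lra.
by have := sz n (leqnn n); rewrite /z divff ?lt0r_neq0 // mul1r addrC subrK.
Qed.

Section Extinction.
Context {R : realType}.
Variables (u du : R -> R) (p q C : R).
Hypotheses (uH1 : H1_on `[p, q] u du) (pq : p <= q) (C0 : 0 <= C).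

Let itvpq : is_interval `[p, q]%classic := @interval_is_interval _ _.
Let inpq x : p <= x <= q -> `[p, q]%classic x.
Proof. by rewrite /= in_itv. Qed.
Let catE x y : p <= x -> x <= y -> y <= q ->
  Lpow 2 `[p, x] u + Lpow 2 `[x, y] u = Lpow 2 `[p, y] u.
Proof.
move=> px xy yq; apply: (@Lpow_cat _ _ _ _ _ (BRight y)) => //.
apply: integrableS (H1_sqr_integrable uH1) => //; apply: subset_itvl; exact: yq.
Qed.

Let Lpow2_le x y r : p <= x -> x <= y -> y <= q ->
  (forall t, x <= t <= y -> u t ^+ 2 <= r) -> Lpow 2 `[x, y] u <= r * (y - x).
Proof.
move=> px xy yq; apply: (Lpow2_seg_le itvpq uH1) => //; apply: inpq.
  by rewrite px (le_trans xy).
by rewrite yq (le_trans px).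
Qed.

Let zero_on x y t : p <= x -> x < y -> y <= q -> Lpow 2 `[x, y] u = 0 -> x <= t <= y -> u t = 0.
Proof.
move=> px xy yq; have xpq : p <= x <= q by rewrite px (le_trans (ltW xy)).
have ypq : p <= y <= q by rewrite yq (le_trans px (ltW xy)).
exact: (Lpow2_seg_eq0 itvpq uH1 xy (inpq xpq) (inpq ypq)).
Qed.

Lemma H1_no_extinction_right : u q = 0 ->
  (forall x, p <= x <= q -> 0 < Lpow 2 `[x, q] u -> u x ^+ 2 <= C * Lpow 2 `[x, q] u) ->
  Lpow 2 `[p, q] u = 0.
Proof.
move=> uq uC; pose s x := Lpow 2 `[x, q] u; have s_ge0 x : 0 <= s x by exact: Lpow_ge0.
have sE y z : p <= y -> y <= z -> z <= q -> s y = Lpow 2 `[y, z] u + s z.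
  move=> py yz zq; have := catE py (le_trans yz zq) (lexx q).
  have := catE (le_trans py yz) zq (lexx q); have := catE py yz zq; rewrite /s => *; lra.
have {}uC x : p <= x <= q -> u x ^+ 2 <= C * s x.
  move=> xpq; have := s_ge0 x; rewrite le_eqVlt => /predU1P[s0|]; last exact: uC.
  have /andP[px] := xpq; rewrite le_eqVlt => /predU1P[->|xq]; first by rewrite uq expr0n mulr_ge0.
  by rewrite (zero_on px xq (lexx q) (esym s0)) ?expr0n ?mulr_ge0 // lexx ltW.
apply: (@gronwall_eq0 _ s p q C q p) => // [y z /andP[py yq] /andP[pz zq]|||];
  rewrite ?lexx ?pq ?andbT //; last by rewrite /s Lpow_set1.
have [yz|/ltW zy] := leP y z; last first.
  rewrite (sE z y) // opprD addrCA subrr addr0; apply: (@le_trans _ _ 0).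
    by rewrite oppr_le0 Lpow_ge0.
  by rewrite !mulr_ge0.
rewrite (sE y z) // addrK -(sE y z) // distrC ger0_norm ?subr_ge0 //.
apply: Lpow2_le => // t /andP[yt tz]; have pt := le_trans py yt; have tq := le_trans tz zq.
apply: le_trans (uC t _) _; first by rewrite pt.
by rewrite ler_wpM2l // (sE y t) // lerDr Lpow_ge0.
Qed.

Lemma H1_no_extinction_left : u p = 0 ->
  (forall x, p <= x <= q -> 0 < Lpow 2 `[p, x] u -> u x ^+ 2 <= C * Lpow 2 `[p, x] u) ->
  Lpow 2 `[p, q] u = 0.
Proof.
move=> up uC; pose s x := Lpow 2 `[p, x] u; have s_ge0 x : 0 <= s x by exact: Lpow_ge0.
have {}uC x : p <= x <= q -> u x ^+ 2 <= C * s x.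
  move=> xpq; have := s_ge0 x; rewrite le_eqVlt => /predU1P[s0|]; last exact: uC.
  have /andP[+ xq] := xpq; rewrite le_eqVlt => /predU1P[<-|px]; first by rewrite up expr0n mulr_ge0.
  by rewrite (zero_on (lexx p) px xq (esym s0)) ?expr0n ?mulr_ge0 // lexx ltW.
apply: (@gronwall_eq0 _ s p q C p q) => // [y z /andP[py yq] /andP[pz zq]|||];
  rewrite ?lexx ?pq ?andbT //; last by rewrite /s Lpow_set1.
have [yz|/ltW zy] := leP y z.
  rewrite /s -(catE py yz zq) opprD addrA subrr sub0r; apply: (@le_trans _ _ 0).
    by rewrite oppr_le0 Lpow_ge0.
  by rewrite !mulr_ge0 ?Lpow_ge0.
rewrite {1}/s -(catE pz zy yq) addrC addKr ger0_norm ?subr_ge0 //.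
apply: Lpow2_le => // t /andP[zt ty]; have pt := le_trans pz zt; have tq := le_trans ty yq.
apply: le_trans (uC t _) _; first by rewrite pt.
by rewrite ler_wpM2l // /s -(catE pt ty yq) lerDl Lpow_ge0.
Qed.

End Extinction.

Lemma sqr_integrable_seg (R : realType) (f : R -> R) (p q : R) : measurable_fun `[p, q] f ->
  lebesgue_measure.-integrable `[p, q]%classic (EFin \o (fun t => f t ^+ 2)) ->
  lebesgue_measure.-integrable `[p, q]%classic (EFin \o f).
Proof.
move=> mf itf2; have it1 := integrable_addf (measurable_itv _) (integrable_cst_seg p q 1) itf2.
apply: le_integrable it1 => //; first exact/measurable_EFinP.
move=> x _ /=; rewrite lee_fin [leRHS]ger0_norm ?addr_ge0 ?sqr_ge0 //.
have := sqr_ge0 (1 - `|f x|); rewrite -[f x ^+ 2]real_normK ?num_real //.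
by have := sqr_ge0 `|f x|; lra.
Qed.

Lemma normr_even_pow (R : realDomainType) (x : R) n : ~~ odd n -> `|x| ^+ n = x ^+ n.
Proof. by move=> evn; rewrite -normrX ger0_norm // exprn_even_ge0. Qed.

Section Edges.
Context {R : realType} {G : graph R}.
Local Notation mu := (@lebesgue_measure R).
Implicit Types (e : 'I_(nE G)) (u du : 'I_(nE G) -> R -> R) (x y : R).

Definition edge_end e : itv_bound R := if bnd G e then BRight (len G e) else +oo%O.

Lemma edge_domE e : edge_dom G e = [set` Interval (BLeft 0) (edge_end e)].
Proof. by rewrite /edge_dom /edge_end; case: ifP. Qed.

Lemma edge_dom_itv e : is_interval (edge_dom G e).
Proof. by rewrite edge_domE; exact: interval_is_interval. Qed.

Lemma measurable_edge_dom e : measurable (edge_dom G e : set R).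
Proof. by rewrite edge_domE; exact: measurable_itv. Qed.

Lemma edge_domP e x : edge_dom G e x <-> 0 <= x /\ (bnd G e -> x <= len G e).
Proof.
rewrite edge_domE /edge_end /= in_itv /=; case: (bnd G e) => /=.
  by split=> [/andP[-> xl]|[-> ->]].
by rewrite andbT; split=> [->|[]].
Qed.

Lemma edge_dom0 e : wf_graph G -> edge_dom G e 0.
Proof. by move=> wf; apply/edge_domP; split=> // be; exact/ltW/wf. Qed.

Lemma edge_dom_len e : wf_graph G -> bnd G e -> edge_dom G e (len G e).
Proof. by move=> wf be; apply/edge_domP; split=> // ; exact/ltW/wf. Qed.

Lemma edge_end_ge e x : edge_dom G e x -> (BRight x <= edge_end e)%O.
Proof.
by move=> /edge_domP[_]; rewrite /edge_end; case: (bnd G e) => // /(_ isT); rewrite bnd_simp.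
Qed.

Lemma is_H1_on u du e : wf_graph G -> is_H1 G u du -> H1_on (edge_dom G e) (u e) (du e).
Proof.
move=> wf [mu_ [mdu [u2 [du2 [duE _]]]]]; have mD := measurable_edge_dom e.
have it_sqr (f : R -> R) : measurable_fun (edge_dom G e) f ->
    (\int[mu]_(x in edge_dom G e) (f x ^+ 2)%:E < +oo)%E ->
    mu.-integrable (edge_dom G e) (EFin \o (fun x => f x ^+ 2)).
  move=> mf foo; apply/integrableP; split.
    by apply/measurable_EFinP; exact: measurable_funX.
  by under eq_integral do rewrite /= ger0_norm ?sqr_ge0 //; exact: foo.
have it_du2 := it_sqr _ (mdu e) (du2 e).
have inD p q : p <= q -> `[p, q]%classic `<=` edge_dom G e -> edge_dom G e p /\ edge_dom G e q.
  by move=> pq pqD; split; apply: pqD; rewrite /= in_itv /= lexx ?pq.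
have it_du q : edge_dom G e q -> mu.-integrable `[0, q]%classic (EFin \o du e).
  move=> Dq; have sub := is_interval_seg_sub (@edge_dom_itv e) (edge_dom0 e wf) Dq.
  apply: sqr_integrable_seg; first exact: measurable_funS (mdu e).
  exact: integrableS it_du2.
split; [exact: mu_|exact: it_sqr|exact: it_du2|move=> p q pq /(inD _ _ pq)[Dp Dq]].
have /edge_domP[p0 _] := Dp.
split=> [|x y px xy yq]; first exact: integrable_sub_seg (it_du q Dq) p0 (lexx q).
have x0 : 0 <= x by exact: le_trans px.
have Dy := edge_dom_itv Dp Dq (introT andP (conj (le_trans px xy) yq)).
have Dx := edge_dom_itv Dp Dq (introT andP (conj px (le_trans xy yq))).
rewrite -(addKr (\int[mu]_(t in `[0, x]) du e t) (\int[mu]_(t in `[x, y]) du e t)).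
rewrite (@Rintegral_itv_cat _ _ _ _ (BRight y)) ?bnd_simp //; last exact: it_du.
by rewrite /Rintegral !duE //=; ring.
Qed.

Lemma Lp_powE n u : ~~ odd n ->
  (forall e, mu.-integrable (edge_dom G e) (EFin \o (fun x => u e x ^+ n))) ->
  Lp_pow G n u = (\sum_e Lpow n (edge_dom G e) (u e))%:E.
Proof.
move=> evn itu; rewrite /Lp_pow -sumEFin; apply: eq_bigr => e _.
under eq_integral do rewrite normr_even_pow //.
rewrite /Lpow /Rintegral fineK //.
exact: (@integrable_fin_num _ _ _ mu _ (measurable_edge_dom e) _ (itu e)).
Qed.

End Edges.
Arguments edge_dom_itv {R G} e [x y] _ _ [z] _.

Section LowerBound.
Context {R : realType} {G : graph R}.
Local Notation mu := (@lebesgue_measure R).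
Variables (u du : 'I_(nE G) -> R -> R) (phi : 'I_(nV G) -> R).
Hypotheses (wf : wf_graph G) (uH1 : is_H1 G u du)
  (u_src : forall e, u e 0 = phi (src G e))
  (u_tgt : forall e, bnd G e -> u e (len G e) = phi (tgt G e)).
Implicit Types (e : 'I_(nE G)) (v : 'I_(nV G)) (L : seq 'I_(nE G)) (b x M : R).

Definition edge_pow n (f : 'I_(nE G) -> R -> R) e : R := Lpow n (edge_dom G e) (f e).

Local Notation m := (edge_pow 2 u).
Local Notation q := (edge_pow 2 du).
Local Notation w := (edge_pow 6 u).

Let eH1 e := is_H1_on e wf uH1.

Definition above e x : set R := [set` Interval (BLeft x) (edge_end e)].

Lemma above0 e : above e 0 = edge_dom G e.
Proof. by rewrite edge_domE. Qed.

Lemma aboveE e x : above e x = if bnd G e then `[x, len G e]%classic else `[x, +oo[%classic.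
Proof. by rewrite /above /edge_end; case: ifP. Qed.

Lemma above_sub e x : edge_dom G e x -> above e x `<=` edge_dom G e.
Proof.
by move=> /edge_domP[x0 _]; rewrite edge_domE /above; apply: subset_itvr; rewrite bnd_simp.
Qed.

Lemma edge_pow_cat n e x : edge_dom G e x ->
  Lpow n.+2 `[0, x] (u e) + Lpow n.+2 (above e x) (u e) = edge_pow n.+2 u e.
Proof.
move=> Dx; have /edge_domP[x0 _] := Dx; rewrite /edge_pow edge_domE /above.
apply: Lpow_cat x0 (edge_end_ge Dx); rewrite -edge_domE.
exact: (H1_pow_integrable (edge_dom_itv e) (eH1 e)).
Qed.

Lemma edge_dpow_cat e x : edge_dom G e x ->
  Lpow 2 `[0, x] (du e) + Lpow 2 (above e x) (du e) = q e.
Proof.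
move=> Dx; have /edge_domP[x0 _] := Dx; rewrite /edge_pow edge_domE /above.
apply: Lpow_cat x0 (edge_end_ge Dx); rewrite -edge_domE.
exact: H1_dsqr_integrable (eH1 e).
Qed.

Lemma calibrated_below b e x : 0 <= b -> edge_dom G e x ->
  calibrated b (u e x) (phi (src G e)) (Lpow 2 `[0, x] (u e)) (Lpow 2 `[0, x] (du e))
    (Lpow 6 `[0, x] (u e)).
Proof.
move=> b0 Dx; have /edge_domP[x0 _] := Dx; apply: calibrated_sym; rewrite -u_src.
exact: (calibrated_seg (edge_dom_itv e) (eH1 e) b0 (edge_dom0 e wf) Dx x0).
Qed.

Lemma calibrated_above b e x : 0 <= b -> edge_dom G e x ->
  calibrated b (u e x) (if bnd G e then phi (tgt G e) else 0) (Lpow 2 (above e x) (u e))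
    (Lpow 2 (above e x) (du e)) (Lpow 6 (above e x) (u e)).
Proof.
move=> b0 Dx; have /edge_domP[x0 xl] := Dx; rewrite aboveE.
have [be|be] := boolP (bnd G e).
  rewrite -u_tgt //.
  exact: (calibrated_seg (edge_dom_itv e) (eH1 e) b0 Dx (edge_dom_len wf be) (xl be)).
apply: calibrated_halfline b0 _; have := H1_onS (edge_dom_itv e) (eH1 e) _ (above_sub Dx).
by rewrite aboveE (negbTE be); apply.
Qed.

Lemma calibrated_edge b e v v' : 0 <= b -> joins e v v' ->
  calibrated b (phi v) (phi v') (m e) (q e) (w e).
Proof.
move=> b0 /joinsP[be ends]; have := calibrated_above b0 (edge_dom0 e wf).
rewrite above0 be u_src; case: ends => -[-> ->] //; exact: calibrated_sym.
Qed.

Lemma calibrated_spath b v L : 0 < b -> spath v L ->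
  calibrated b (phi v) 0 (\sum_(e <- L) m e) (\sum_(e <- L) q e) (\sum_(e <- L) w e).
Proof.
move=> b0; elim=> [e be|e {}v v' {}L ej pL IH nv].
  have := calibrated_above (ltW b0) (edge_dom0 e wf).
  by rewrite above0 (negbTE be) u_src !big_seq1.
by rewrite !big_cons; apply: calibrated_cat IH => //; apply: calibrated_edge ej; exact: ltW.
Qed.

Lemma edge_pow_ge0 n f e : ~~ odd n -> 0 <= edge_pow n f e.
Proof. exact: Lpow_ge0. Qed.

Lemma Lpow_below_gt0 n e x : ~~ odd n -> edge_dom G e x -> 0 < x -> u e x != 0 ->
  0 < Lpow n.+2 `[0, x] (u e).
Proof.
move=> evn Dx x0; apply: (Lpow_seg_gt0 (edge_dom_itv e) (eH1 e) evn x0 (edge_dom0 e wf) Dx).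
by rewrite lexx ltW.
Qed.

Lemma Lpow_above_gt0 n e x : ~~ odd n -> edge_dom G e x -> (bnd G e -> x < len G e) ->
  u e x != 0 -> 0 < Lpow n.+2 (above e x) (u e).
Proof.
move=> evn Dx xl ux; have xS := above_sub Dx.
have aitv : is_interval (above e x) by exact: interval_is_interval.
have aH1 := H1_onS (edge_dom_itv e) (eH1 e) (is_interval_measurable aitv) xS.
have [y xy ay] : exists2 y, x < y & above e x y.
  rewrite aboveE; case: (boolP (bnd G e)) => be.
    exists (len G e); first exact: xl.
    by rewrite /= in_itv /= lexx andbT; exact/ltW/xl.
  by exists (x + 1); rewrite ?ltrDl //= in_itv /= andbT lerDl.
have ax : above e x x.
  rewrite aboveE; case: (boolP (bnd G e)) => be; rewrite /= in_itv /= lexx //=.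
  exact/ltW/xl.
apply: lt_le_trans (Lpow_seg_le aitv aH1 evn ax ay).
by apply: (Lpow_seg_gt0 aitv aH1 evn xy ax ay _ ux); rewrite lexx ltW.
Qed.

Lemma edge_pow_gt0 n e x : ~~ odd n -> edge_dom G e x -> u e x != 0 -> 0 < edge_pow n.+2 u e.
Proof.
move=> evn Dx ux; rewrite -(edge_pow_cat n Dx).
have ge_below : 0 <= Lpow n.+2 `[0, x] (u e) by rewrite Lpow_ge0 //= negbK.
have ge_above : 0 <= Lpow n.+2 (above e x) (u e) by rewrite Lpow_ge0 //= negbK.
have /edge_domP[] := Dx; rewrite le_eqVlt => /predU1P[x0 _|x0 _]; last first.
  by rewrite ltr_pwDl // Lpow_below_gt0.
by rewrite ltr_wpDl // Lpow_above_gt0 // -x0 => /wf.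
Qed.

Lemma touches_mass_gt0 e v : touches e v -> phi v != 0 -> 0 < m e.
Proof.
move=> /orP[/eqP <-|/andP[be /eqP <-]].
  by rewrite -u_src; apply: edge_pow_gt0 => //; exact: edge_dom0.
by rewrite -u_tgt //; apply: edge_pow_gt0 => //; exact: edge_dom_len.
Qed.

Lemma sum_mass_ge0 (I : Type) (r : seq I) (P : pred I) (F : I -> 'I_(nE G)) :
  0 <= \sum_(i <- r | P i) m (F i).
Proof. by apply: sumr_ge0 => i _; exact: edge_pow_ge0. Qed.

Lemma spath_mass_gt0 v L : spath v L -> phi v != 0 -> 0 < \sum_(e <- L) m e.
Proof.
move=> pL pv; have /hasP[e eL ev] := spath_visits pL.
rewrite (perm_big _ (perm_to_rem eL)) big_cons /=.
by rewrite ltr_wpDr ?sum_mass_ge0 // (touches_mass_gt0 ev).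
Qed.

Lemma edge_sextic_le e M : 0 <= M -> (forall x, edge_dom G e x -> `|u e x| <= M) ->
  w e <= M ^+ 4 * m e.
Proof. exact: (Lpow_le (edge_dom_itv e) (eH1 e) 4). Qed.

Section EqualityPath.
Variables (b M : R).
Hypotheses (b0 : 0 < b) (M0 : M != 0)
  (uM : forall e x, edge_dom G e x -> `|u e x| <= `|M|).

(* Otherwise the mass ahead, decreasing at rate [u ^ 2], vanishes in finite length
   although [u ^ 2] is at most a multiple of it. *)
Lemma mass_ahead_gt0 e v v' m1 q1 w1 s q2 w2 : joins e v v' ->
  calibrated b M (phi v) m1 q1 w1 -> calibrated b (phi v') 0 s q2 w2 ->
  2 * b * (m1 + (m e + s)) = pi / 2 -> q1 + (q e + q2) = b ^+ 2 * (w1 + (w e + w2)) ->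
  (s = 0 -> phi v' = 0) -> 0 < m e + s -> 0 < s.
Proof.
move=> ej before after tot eqw s_phi ms0; have [s_ge0 _] := after.
rewrite lt_def s_ge0 andbT; apply/eqP => s0; have phi0 := s_phi s0.
have bD := ltW b0; have /joinsP[be ends] := ej.
have cut x mb qb wb ma qa wa : edge_dom G e x ->
    calibrated b (phi v) (u e x) mb qb wb -> calibrated b (u e x) (phi v') ma qa wa ->
    mb + ma = m e -> qb + qa = q e -> wb + wa = w e -> 0 < ma ->
    u e x ^+ 2 <= 4 * b * M ^+ 2 * ma.
  move=> Dx calb cala mE qE wE ma0.
  have pre := calibrated_cat b0 before calb; have post := calibrated_cat b0 cala after.
  have := calibrated_eq_sqr_le b0 pre post; rewrite s0 addr0; apply=> //.
  - by rewrite -addrA mE -tot s0 addr0.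
  - have -> : q1 + qb + (qa + q2) = q1 + (qb + qa + q2) by ring.
    by rewrite qE eqw -wE; congr (_ * _); ring.
  - exact: uM.
have l0 := ltW (wf be).
have DE : edge_dom G e = `[0, len G e]%classic by rewrite /edge_dom be.
have above_len x : above e x = `[x, len G e]%classic by rewrite aboveE be.
have H1e : H1_on `[0, len G e] (u e) (du e) by rewrite -DE; exact: eH1.
have C0 : 0 <= 4 * b * M ^+ 2 by rewrite mulr_ge0 ?sqr_ge0 // mulr_ge0.
suff me0 : m e = 0 by rewrite me0 s0 addr0 ltxx in ms0.
rewrite /edge_pow DE; case: ends => -[sv tv].
  apply: (H1_no_extinction_right H1e l0 C0); first by rewrite u_tgt // tv.
  move=> x xe; have Dx : edge_dom G e x by rewrite DE /= in_itv.
  rewrite -above_len; apply: (cut x _ _ _ _ _ _ Dx) (edge_pow_cat 0 Dx) (edge_dpow_cat Dx)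
    (edge_pow_cat 4 Dx).
    by rewrite -sv; apply: calibrated_sym; exact: calibrated_below.
  by have := calibrated_above bD Dx; rewrite be tv.
apply: (H1_no_extinction_left H1e l0 C0); first by rewrite u_src sv.
move=> x xe; have Dx : edge_dom G e x by rewrite DE /= in_itv.
apply: (cut x _ _ _ _ _ _ Dx); last 3 first.
- by rewrite addrC; exact: (edge_pow_cat 0 Dx).
- by rewrite addrC; exact: (edge_dpow_cat Dx).
- by rewrite addrC; exact: (edge_pow_cat 4 Dx).
- by have := calibrated_above bD Dx; rewrite be tv => /calibrated_sym.
- by rewrite -sv; exact: calibrated_below.
Qed.

Lemma spath_nonvanishing v L m1 q1 w1 : spath v L -> calibrated b M (phi v) m1 q1 w1 ->
  2 * b * (m1 + \sum_(e <- L) m e) = pi / 2 ->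
  q1 + \sum_(e <- L) q e = b ^+ 2 * (w1 + \sum_(e <- L) w e) ->
  0 < \sum_(e <- L) m e ->
  forall v', visits L v' -> phi v' != 0.
Proof.
move=> pL; elim: pL m1 q1 w1 => [e be|e {}v v1 {}L ej pL IH nv] m1 q1 w1 cal tot eqw mL v'.
  rewrite /visits /= orbF touches_half // => /eqP ->.
  exact: (calibrated_eq_neq0 b0 cal (calibrated_spath b0 (spath_half be)) tot eqw).
have pv : phi v != 0.
  exact: (calibrated_eq_neq0 b0 cal (calibrated_spath b0 (spath_step ej pL nv)) tot eqw).
rewrite !big_cons in tot eqw mL.
have mass0_phi : \sum_(e <- L) m e = 0 -> phi v1 = 0.
  move=> mL0; apply/eqP; apply: contraT => pv1.
  by have := spath_mass_gt0 pL pv1; rewrite mL0 ltxx.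
have mL' := mass_ahead_gt0 ej cal (calibrated_spath b0 pL) tot eqw mass0_phi mL.
have nz := IH _ _ _ (calibrated_cat b0 cal (calibrated_edge (ltW b0) ej))
  ltac:(by rewrite -addrA) ltac:(by rewrite -!addrA) mL'.
rewrite /visits /= (touches_joins _ ej) -orbA => /or3P[/eqP ->//|/eqP ->|]; last exact: nz.
exact: nz (spath_visits pL).
Qed.

End EqualityPath.

Lemma edge_max e : exists2 x, edge_dom G e x &
  forall t, edge_dom G e t -> `|u e t| <= `|u e x|.
Proof.
have max_seg l : edge_dom G e l -> exists2 x, 0 <= x <= l &
    forall t, 0 <= t <= l -> `|u e t| <= `|u e x|.
  move=> Dl; have /edge_domP[l0 _] := Dl.
  have cu : {within `[0, l], continuous (fun t => `|u e t|)}.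
    apply/subspace_continuousP => t tl; apply: cvg_norm.
    have := H1_continuous (edge_dom_itv e) (eH1 e) (edge_dom0 e wf) Dl.
    by move=> /subspace_continuousP; apply.
  have [x xl ux] := EVT_max l0 cu; exists x; first by move: xl; rewrite in_itv.
  by move=> t tl; apply: ux; rewrite in_itv.
have [be|be] := boolP (bnd G e).
  have [x /andP[x0 xl] ux] := max_seg _ (edge_dom_len wf be).
  by exists x => [|t]; [apply/edge_domP|move=> /edge_domP[t0 /(_ be) tl]; apply: ux; rewrite t0].
have inD x : edge_dom G e x <-> 0 <= x.
  by rewrite edge_domP; split=> [[]//|x0]; split=> // be'; rewrite be' in be.
have [[y Dy uy]|none] := pselect (exists2 y, edge_dom G e y & u e y != 0); last first.
  exists 0 => [|t Dt]; first exact: edge_dom0.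
  suff -> : u e t = 0 by rewrite normr0.
  by apply/eqP; apply: contraT => ut; case: none; exists t.
have uy0 : 0 < `|u e y| by rewrite normr_gt0.
have DE : edge_dom G e = `[0, +oo[%classic by rewrite /edge_dom (negbTE be).
have [N [_ small]] : \forall t \near +oo, `|0 - u e t| <= `|u e y|.
  by apply: cvgr_dist_le uy0; have := eH1 e; rewrite DE; exact: H1_cvg_pinfty.
pose l := Num.max (N + 1) y; have yl : y <= l by rewrite le_max lexx orbT.
have l0 : 0 <= l by apply: le_trans yl; apply/inD.
have [x /andP[x0 xl] ux] := max_seg l ltac:(exact/inD).
exists x => [|t /inD t0]; first exact/inD.
have [tl|lt] := leP t l; first by apply: ux; rewrite t0.
apply: le_trans (ux y _); last by rewrite yl andbT; apply/inD.
rewrite -normrN -sub0r; apply: small; apply: le_lt_trans lt.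
by rewrite le_max; apply/orP; left; rewrite lerDl.
Qed.

Lemma graph_max : noncompact G -> exists e0 x0, edge_dom G e0 x0 /\
  forall e x, edge_dom G e x -> `|u e x| <= `|u e0 x0|.
Proof.
move=> [e1 _]; have /choice[X X_max] : forall e, exists x, edge_dom G e x /\
    forall t, edge_dom G e t -> `|u e t| <= `|u e x|.
  by move=> e; have [x ? ?] := edge_max e; exists x.
have [e0 _ e0_max] :=
  @Order.TotalTheory.arg_maxP _ _ _ e1 xpredT (fun e => `|u e (X e)|) isT.
exists e0, (X e0); split=> [|e x Dx]; first by have [] := X_max e0.
by apply: le_trans (e0_max e isT); have [_] := X_max e; apply.
Qed.

Lemma sum_split (K : seq 'I_(nE G)) (f : 'I_(nE G) -> R) : uniq K ->
  \sum_e f e = \sum_(e <- K) f e + \sum_(e | e \notin K) f e.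
Proof. by move=> uK; rewrite (bigID (mem K)) /= (big_uniq _ uK). Qed.

Section Maximum.
Variables (b M : R).
Hypotheses (cG : connected_graph G) (nG : noncompact G) (b0 : 0 < b) (M0 : M != 0)
  (tot : 2 * b * (\sum_e m e) = pi / 2)
  (uM : forall e x, edge_dom G e x -> `|u e x| <= `|M|).

Lemma sum_sextic_le (P : pred 'I_(nE G)) :
  \sum_(e | P e) w e <= M ^+ 4 * \sum_(e | P e) m e.
Proof.
rewrite mulr_sumr; apply: ler_sum => e _; rewrite -normr_even_pow //.
exact: edge_sextic_le (uM (e := e)).
Qed.

Lemma max_at_cut_strict e0 L mA qA wA mB qB wB : uniq (e0 :: L) ->
  calibrated b M 0 (mA + \sum_(e <- L) m e) (qA + \sum_(e <- L) q e)
    (wA + \sum_(e <- L) w e) ->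
  mA + mB = m e0 -> qA + qB = q e0 -> wA + wB = w e0 -> 0 <= qB -> wB <= M ^+ 4 * mB ->
  0 < mA -> 0 < mB -> b ^+ 2 * \sum_e w e < \sum_e q e.
Proof.
move=> uL cal mE qE wE qB0 wBle mA0 mB0.
have mL : 0 <= \sum_(e <- L) m e by rewrite sumr_ge0 // => e _; exact: edge_pow_ge0.
have mR : 0 <= \sum_(e | e \notin e0 :: L) m e by exact: sum_mass_ge0 id.
have qR : 0 <= \sum_(e | e \notin e0 :: L) q e.
  by rewrite sumr_ge0 // => e _; exact: edge_pow_ge0.
have wR := sum_sextic_le (fun e => e \notin e0 :: L).
move: tot; rewrite !(sum_split _ uL) !big_cons -mE -qE -wE => totE.
have mP0 : 0 < mA + \sum_(e <- L) m e by rewrite ltr_wpDr.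
have mr0 : 0 < mB + \sum_(e | e \notin e0 :: L) m e by rewrite ltr_wpDr.
have [] := @calibrated_rest_le _ b b0 _ _ _ _ _
  (qA + qB + \sum_(e <- L) q e + \sum_(e | e \notin e0 :: L) q e)
  (wA + wB + \sum_(e <- L) w e + \sum_(e | e \notin e0 :: L) w e) cal mP0 (ltW mr0) _ _ _.
- by rewrite -totE; congr (_ * _); ring.
- by lra.
- by lra.
move=> sharp rest0; rewrite lt_neqAle sharp andbT; apply/eqP => /esym eqw.
by have := rest0 M0 eqw => mr; rewrite mr ltxx in mr0.
Qed.

Lemma sextic_below_le e x : edge_dom G e x ->
  Lpow 6 `[0, x] (u e) <= M ^+ 4 * Lpow 2 `[0, x] (u e).
Proof.
move=> Dx; have sub := is_interval_seg_sub (edge_dom_itv e) (edge_dom0 e wf) Dx.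
have bH1 := H1_onS (edge_dom_itv e) (eH1 e) (measurable_itv _) sub.
rewrite -normr_even_pow //; apply: (Lpow_le (@interval_is_interval _ _) bH1 4) => // t /sub.
exact: uM.
Qed.

Lemma sextic_above_le e x : edge_dom G e x ->
  Lpow 6 (above e x) (u e) <= M ^+ 4 * Lpow 2 (above e x) (u e).
Proof.
move=> Dx; have sub := above_sub Dx.
have aH1 := H1_onS (edge_dom_itv e) (eH1 e) (measurable_itv _) sub.
rewrite -normr_even_pow //; apply: (Lpow_le (@interval_is_interval _ _) aH1 4) => // t /sub.
exact: uM.
Qed.

(* The part of the edge of [x0] that a path from [x0] to infinity leaves out has positive
   mass. *)
Lemma interior_max_strict e0 x0 : edge_dom G e0 x0 -> u e0 x0 = M -> 0 < x0 ->
  (bnd G e0 -> x0 < len G e0) -> b ^+ 2 * \sum_e w e < \sum_e q e.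
Proof.
move=> Dx uE x00 x0l; have ux : u e0 x0 != 0 by rewrite uE.
have below_gt0 : 0 < Lpow 2 `[0, x0] (u e0) by exact: (Lpow_below_gt0 (n := 0)).
have above_gt0 : 0 < Lpow 2 (above e0 x0) (u e0) by exact: (Lpow_above_gt0 (n := 0)).
have mE := edge_pow_cat 0 Dx; have wE := edge_pow_cat 4 Dx; have qE := edge_dpow_cat Dx.
have calB := calibrated_below (ltW b0) Dx; have calA := calibrated_above (ltW b0) Dx.
rewrite uE in calA calB.
have strict_above L : uniq (e0 :: L) -> calibrated b M 0
    (Lpow 2 (above e0 x0) (u e0) + \sum_(e <- L) m e)
    (Lpow 2 (above e0 x0) (du e0) + \sum_(e <- L) q e)
    (Lpow 6 (above e0 x0) (u e0) + \sum_(e <- L) w e) -> b ^+ 2 * \sum_e w e < \sum_e q e.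
  move=> uL cal; rewrite addrC in mE; rewrite addrC in qE; rewrite addrC in wE.
  exact: (max_at_cut_strict uL cal mE qE wE (@Lpow_ge0 _ 2 _ _ isT) (sextic_below_le Dx)).
have [be|be] := boolP (bnd G e0); last first.
  by apply: (strict_above [::]) => //; rewrite !big_nil !addr0; rewrite (negbTE be) in calA.
rewrite be in calA; have [L e0L [pL|pL]] := spath_avoid cG nG be.
  have uL : uniq (e0 :: L) by rewrite /= e0L (spath_uniq pL).
  have cal := calibrated_cat b0 calB (calibrated_spath b0 pL).
  exact: (max_at_cut_strict uL cal mE qE wE (@Lpow_ge0 _ 2 _ _ isT) (sextic_above_le Dx)).
apply: (strict_above L); first by rewrite /= e0L (spath_uniq pL).
exact: (calibrated_cat b0 calA (calibrated_spath b0 pL)).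
Qed.

Lemma vertex_max_le v : phi v = M ->
  b ^+ 2 * \sum_e w e <= \sum_e q e /\
  (\sum_e q e = b ^+ 2 * \sum_e w e -> is_halfline G).
Proof.
move=> vM; have [L pL] := spath_exists v cG nG; have uL := spath_uniq pL.
have cal := calibrated_spath b0 pL; rewrite vM in cal.
have mL : 0 < \sum_(e <- L) m e by apply: spath_mass_gt0 pL _; rewrite vM.
have mR : 0 <= \sum_(e | e \notin L) m e by rewrite sumr_ge0 // => e _; exact: edge_pow_ge0.
have qR : 0 <= \sum_(e | e \notin L) q e by rewrite sumr_ge0 // => e _; exact: edge_pow_ge0.
have wR := sum_sextic_le (fun e => e \notin L).
move: tot; rewrite !(sum_split _ uL) => totE.
have [sharp rest0] := @calibrated_rest_le _ b b0 _ _ _ _ _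
  (\sum_(e <- L) q e + \sum_(e | e \notin L) q e)
  (\sum_(e <- L) w e + \sum_(e | e \notin L) w e) cal mL mR totE ltac:(lra) ltac:(lra).
split=> // eqw; have mr0 := rest0 M0 eqw.
have mass_off e : e \notin L -> m e = 0.
  move=> eL; move/eqP: mr0; rewrite psumr_eq0; last by move=> e' _; exact: edge_pow_ge0.
  by move=> /allP /(_ e (mem_index_enum e)); rewrite eL /= => /eqP.
rewrite mr0 mulr0 in wR; rewrite mr0 addr0 in totE.
have [sharp_path _] := @calibrated_rest_le _ b b0 _ _ _ _ 0 (\sum_(e <- L) q e) (\sum_(e <- L) w e)
  cal mL (lexx 0) ltac:(by rewrite addr0) (lexx _) ltac:(by rewrite mulr0 addr0).
have eqL : \sum_(e <- L) q e = b ^+ 2 * \sum_(e <- L) w e.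
  apply/eqP; rewrite eq_le sharp_path andbT.
  have : b ^+ 2 * \sum_(e | e \notin L) w e <= 0 by rewrite mulr_ge0_le0 ?sqr_ge0.
  by lra.
have nilM := calibrated_nil b M; rewrite -{2}vM in nilM.
have nz := @spath_nonvanishing b M b0 M0 uM v L 0 0 0 pL nilM
  ltac:(by rewrite add0r) ltac:(by rewrite !add0r) mL.
apply: (spath_all_is_halfline pL); apply: (spath_closed_all cG pL) => e v' /nz pv' ev'.
by apply: contraT => eL; have := touches_mass_gt0 ev' pv'; rewrite mass_off // ltxx.
Qed.

End Maximum.

Lemma edge_pow_sharp : connected_graph G -> noncompact G -> 0 < \sum_e m e ->
  let b := pi / (4 * \sum_e m e) in
  [/\ 0 < \sum_e w e, b ^+ 2 * \sum_e w e <= \sum_e q e &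
   (\sum_e q e = b ^+ 2 * \sum_e w e -> is_halfline G)].
Proof.
move=> cG nG msum0 b; have b0 : 0 < b by rewrite divr_gt0 ?pi_gt0 // mulr_gt0.
have tot : 2 * b * (\sum_e m e) = pi / 2 by rewrite /b; field; rewrite lt0r_neq0.
have [e0 [x0 [Dx uM]]] := graph_max nG.
have M0 : u e0 x0 != 0.
  apply: contraTneq msum0 => u0; rewrite -leNgt; apply: sumr_le0 => e _.
  rewrite /edge_pow /Lpow (@eq_Rintegral _ _ _ _ _ (cst 0)).
    by rewrite Rintegral_cst ?mul0r //; exact: measurable_edge_dom.
  by move=> x /set_mem /uM; rewrite u0 normr0 normr_le0 => /eqP ->; rewrite expr0n.
have w0 : 0 < \sum_e w e.
  rewrite (bigD1 e0) //= ltr_wpDr ?(edge_pow_gt0 (isT : ~~ odd 4) Dx) //.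
  by rewrite sumr_ge0 // => e _; exact: edge_pow_ge0.
have at_vertex v : phi v = u e0 x0 -> [/\ 0 < \sum_e w e,
    b ^+ 2 * \sum_e w e <= \sum_e q e & \sum_e q e = b ^+ 2 * \sum_e w e -> is_halfline G].
  by move=> /(vertex_max_le cG nG b0 M0 tot uM)[].
have /edge_domP[] := Dx; rewrite le_eqVlt => /predU1P[x00 _|x00 x0l].
  by apply: (at_vertex (src G e0)); rewrite -u_src x00.
have [[be x0E]|inside] := pselect (bnd G e0 /\ x0 = len G e0).
  by apply: (at_vertex (tgt G e0)); rewrite -u_tgt // x0E.
have strict : b ^+ 2 * \sum_e w e < \sum_e q e.
  apply: (interior_max_strict cG nG b0 M0 tot uM Dx erefl x00) => be.
  by rewrite lt_neqAle x0l // andbT; apply/eqP => x0E; exact: inside.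
by split=> [//||eqw]; [exact: ltW|rewrite eqw ltxx in strict].
Qed.

End LowerBound.

Lemma is_H1_Lp_powE (R : realType) (G : graph R) u du : wf_graph G -> is_H1 G u du ->
  [/\ mass G u = (\sum_e edge_pow 2 u e)%:E, Lp_pow G 2 du = (\sum_e edge_pow 2 du e)%:E &
   Lp_pow G 6 u = (\sum_e edge_pow 6 u e)%:E].
Proof.
move=> wf uH1; have eH1 e := is_H1_on e wf uH1.
split; apply: Lp_powE => // e.
- exact: H1_sqr_integrable (eH1 e).
- exact: H1_dsqr_integrable (eH1 e).
- exact: (H1_pow_integrable (edge_dom_itv e) (eH1 e) 4).
Qed.

Lemma sharp_inequality (R : realType) (G : graph R) u du (mu : R) :
  wf_graph G -> connected_graph G -> noncompact G -> is_H1 G u du ->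
  mass G u = mu%:E -> 0 < mu ->
  exists q w, [/\ Lp_pow G 2 du = q%:E, Lp_pow G 6 u = w%:E, 0 < w,
    (pi / (4 * mu)) ^+ 2 * w <= q & (q = (pi / (4 * mu)) ^+ 2 * w -> is_halfline G)].
Proof.
move=> wf cG nG uH1 + mu0; have [-> duE uE] := is_H1_Lp_powE wf uH1 => -[muE].
have [_ [_ [_ [_ [_ [phi phiE]]]]]] := uH1.
exists (\sum_e edge_pow 2 du e), (\sum_e edge_pow 6 u e).
have [|||w0 le_qw eq_qw] := @edge_pow_sharp R G u du phi wf uH1 _ _ cG nG.
- by move=> e; have [] := phiE e.
- by move=> e; have [] := phiE e.
- by rewrite muE.
by move: le_qw eq_qw; rewrite muE.
Qed.

(** * The soliton *)

Section Soliton.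
Context {R : realType}.
Local Notation mu := (@lebesgue_measure R).
Implicit Types (x y T d : R).

Definition sech x : R := 2 * expR x / (1 + expR x ^+ 2).
Definition tanh x : R := (expR x ^+ 2 - 1) / (1 + expR x ^+ 2).
Definition soliton x : R := Num.sqrt (sech x).
Definition dsoliton x : R := - (2^-1 * (tanh x * soliton x)).
Definition d2soliton x : R := 4^-1 * soliton x - 3 / 4 * soliton x ^+ 5.

Let den_gt0 x : 0 < 1 + expR x ^+ 2.
Proof. by rewrite ltr_wpDr ?sqr_ge0. Qed.

Let den_neq0 x : 1 + expR x ^+ 2 != 0.
Proof. by rewrite lt0r_neq0. Qed.

Lemma sech_gt0 x : 0 < sech x.
Proof. by rewrite divr_gt0 // mulr_gt0 ?expR_gt0. Qed.

Lemma sech2Dtanh2 x : sech x ^+ 2 + tanh x ^+ 2 = 1.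
Proof. by rewrite /sech /tanh; field. Qed.

Lemma is_derive_sech x : is_derive x (1 : R) sech (- (sech x * tanh x)).
Proof.
by apply: is_derive_eq; rewrite /GRing.scale /= /sech /tanh; field.
Qed.

Lemma is_derive_tanh x : is_derive x (1 : R) tanh (sech x ^+ 2).
Proof.
by apply: is_derive_eq; rewrite /GRing.scale /= /sech; field.
Qed.

Definition gudermann x : R := 2 * atan (expR x) - pi / 2.

Lemma is_derive_gudermann x : is_derive x (1 : R) gudermann (sech x).
Proof.
by apply: is_derive_eq; rewrite /GRing.scale /= /sech; field.
Qed.

Lemma soliton_gt0 x : 0 < soliton x.
Proof. by rewrite sqrtr_gt0 sech_gt0. Qed.

Lemma soliton_sqr x : soliton x ^+ 2 = sech x.
Proof. by rewrite sqr_sqrtr // ltW // sech_gt0. Qed.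

Lemma is_derive_soliton x : is_derive x (1 : R) soliton (dsoliton x).
Proof.
have s0 := lt0r_neq0 (soliton_gt0 x).
apply: is_derive_eq (is_derive1_comp (is_derive1_sqrt (sech_gt0 x)) (is_derive_sech x)) _.
by rewrite -/(soliton x) -{1}soliton_sqr /dsoliton; field.
Qed.

Lemma is_derive_dsoliton x : is_derive x (1 : R) dsoliton (d2soliton x).
Proof.
have dt := is_derive_tanh x; have ds := is_derive_soliton x.
apply: is_derive_eq; rewrite /GRing.scale /= /d2soliton.
have tanh2 : tanh x ^+ 2 = 1 - soliton x ^+ 4.
  by rewrite (exprM _ 2 2) soliton_sqr -(sech2Dtanh2 x) addrC addKr.
have -> : dsoliton x = - (2^-1 * (tanh x * soliton x)) by [].
rewrite -[sech x]soliton_sqr.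
transitivity (2^-1 * (2^-1 * tanh x ^+ 2 * soliton x - soliton x ^+ 5)); first by field.
by rewrite tanh2; field.
Qed.

Lemma dsoliton_sqr x : dsoliton x ^+ 2 = 4^-1 * (soliton x ^+ 2 - soliton x ^+ 6).
Proof.
have tanh2 : tanh x ^+ 2 = 1 - sech x ^+ 2 by rewrite -(sech2Dtanh2 x) addrC addKr.
rewrite /dsoliton (_ : (- _) ^+ 2 = 4^-1 * (tanh x ^+ 2 * soliton x ^+ 2)); last by field.
by rewrite tanh2 (exprM _ 2 3) soliton_sqr; ring.
Qed.

Lemma is_derive_continuous (F f : R -> R) : (forall x, is_derive x (1 : R) F (f x)) ->
  continuous F.
Proof.
by move=> dF x; apply/differentiable_continuous/derivable1_diffP; have [] := dF x.
Qed.

Lemma continuousX (f : R -> R) n : continuous f -> continuous (fun x => f x ^+ n).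
Proof.
by move=> cf x; apply: (@continuous_comp _ _ _ f (fun y => y ^+ n));
  [exact: cf|exact: exprn_continuous].
Qed.

Lemma continuous_soliton : continuous soliton.
Proof. exact: is_derive_continuous is_derive_soliton. Qed.

Lemma continuous_dsoliton : continuous dsoliton.
Proof. exact: is_derive_continuous is_derive_dsoliton. Qed.

Lemma sech_cvg_pinfty : sech x @[x --> +oo] --> (0 : R).
Proof.
apply: (@squeeze_cvgr _ _ _ _ (fun=> 0) (fun x => 2 * expR (- x))).
- near=> x; rewrite (ltW (sech_gt0 x)) /= expRN /sech -mulrA ler_pM2l // ler_pdivrMr //.
  by rewrite mulrDr mulr1 expr2 mulKf ?lt0r_neq0 ?expR_gt0 // lerDr invr_ge0 expR_ge0.
- exact: cvg_cst.
- by rewrite -(mulr0 2); apply: cvgM; [exact: cvg_cst|exact: cvgr_expR].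
Unshelve. all: end_near.
Qed.

Lemma tanh_norm_le1 x : `|tanh x| <= 1.
Proof.
rewrite -(@ler_pXn2r _ 2) ?nnegrE // expr1n real_normK ?num_real //.
by rewrite -(sech2Dtanh2 x) lerDr sqr_ge0.
Qed.

Lemma sech_tanh_cvg_pinfty : (sech x * tanh x : R) @[x --> +oo] --> (0 : R).
Proof.
apply/norm_cvg0P; apply: (@squeeze_cvgr _ _ _ _ (fun=> 0) sech).
- near=> x; rewrite normr_ge0 normrM (gtr0_norm (sech_gt0 x)) /=.
  by rewrite ler_piMr ?tanh_norm_le1 // ltW // sech_gt0.
- exact: cvg_cst.
- exact: sech_cvg_pinfty.
Unshelve. all: end_near.
Qed.

Lemma gudermann_cvg_pinfty : gudermann x @[x --> +oo] --> (pi / 2 : R).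
Proof.
have -> : pi / 2 = 2 * (pi / 2) - pi / 2 :> R by field.
apply: cvgB; last exact: cvg_cst.
apply: cvgM; first exact: cvg_cst.
apply: (@cvg_comp _ _ _ (@expR R) (@atan R) _ +oo); last exact: cvgy_atan.
apply/cvgryPge => c; near=> x; apply: le_trans (expR_ge1Dx x); rewrite -lerBlDl.
by near: x; apply: nbhs_pinfty_ge; exact: num_real.
Unshelve. all: end_near.
Qed.

Lemma gudermann0 : gudermann 0 = 0.
Proof. by rewrite /gudermann expR0 atan1; field. Qed.

Lemma tanh0 : tanh 0 = 0.
Proof. by rewrite /tanh expR0 expr1n subrr mul0r. Qed.

Lemma ge0_FTC2y (f F : R -> R) (l : R) : (forall x, 0 <= f x) -> continuous f ->
  (forall x, is_derive x (1 : R) F (f x)) -> F x @[x --> +oo] --> l ->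
  (\int[mu]_(x in `[0%R, +oo[) (f x)%:E = (l - F 0)%:E)%E.
Proof.
move=> f0 cf dF Fl; have cF := is_derive_continuous dF.
rewrite (ge0_continuous_FTC2y (fun x _ => f0 x) _ Fl) ?EFinB //.
- exact: continuous_subspaceT.
- exact: cvg_at_right_filter (cF 0).
- by move=> x _; rewrite derive1E; have [_ ->] := dF x.
Qed.

Lemma integral_soliton_sqr : (\int[mu]_(x in `[0%R, +oo[) (soliton x ^+ 2)%:E = (pi / 2)%:E)%E.
Proof.
under eq_integral do rewrite soliton_sqr.
rewrite (ge0_FTC2y _ _ is_derive_gudermann gudermann_cvg_pinfty) ?gudermann0 ?subr0 //.
- by move=> x; rewrite ltW // sech_gt0.
- exact: is_derive_continuous is_derive_sech.
Qed.

Lemma integral_soliton_sextic : (\int[mu]_(x in `[0%R, +oo[) (soliton x ^+ 6)%:E = (pi / 4)%:E)%E.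
Proof.
pose F x := 2^-1 * (sech x * tanh x + gudermann x).
have dF x : is_derive x (1 : R) F (soliton x ^+ 6).
  have ds := is_derive_sech x; have dt := is_derive_tanh x.
  have dg := is_derive_gudermann x; apply: is_derive_eq; rewrite /GRing.scale /=.
  have tanh2 : tanh x ^+ 2 = 1 - sech x ^+ 2 by rewrite -(sech2Dtanh2 x) addrC addKr.
  rewrite (exprM _ 2 3) soliton_sqr.
  transitivity (2^-1 * (sech x ^+ 3 - sech x * tanh x ^+ 2 + sech x)); first by ring.
  by rewrite tanh2; field.
have F_cvg : F x @[x --> +oo] --> (pi / 4 : R).
  have -> : pi / 4 = 2^-1 * (0 + pi / 2) :> R by field.
  apply: cvgM; first exact: cvg_cst.
  by apply: cvgD; [exact: sech_tanh_cvg_pinfty|exact: gudermann_cvg_pinfty].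
rewrite (ge0_FTC2y _ _ dF F_cvg).
- by rewrite /F tanh0 gudermann0 mulr0 addr0 mulr0 subr0.
- by move=> x; rewrite exprn_even_ge0.
- exact: continuousX continuous_soliton.
Qed.

Lemma even_pow_integrable (f : R -> R) n (D : set R) r : ~~ odd n -> measurable D ->
  continuous f -> (\int[mu]_(x in D) (f x ^+ n)%:E = r%:E)%E ->
  mu.-integrable D (EFin \o (fun x => f x ^+ n)).
Proof.
move=> evn mD cf Er; apply/integrableP; split.
  apply/measurable_EFinP; apply: measurable_funTS; apply: continuous_measurable_fun.
  exact: continuousX cf.
by under eq_integral do rewrite /= ger0_norm ?exprn_even_ge0 //; rewrite Er ltry.
Qed.

Lemma soliton_sqr_integrable :
  mu.-integrable `[0%R, +oo[%classic (EFin \o (fun x => soliton x ^+ 2)).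
Proof. exact: even_pow_integrable continuous_soliton integral_soliton_sqr. Qed.

Lemma soliton_sextic_integrable :
  mu.-integrable `[0%R, +oo[%classic (EFin \o (fun x => soliton x ^+ 6)).
Proof. exact: even_pow_integrable continuous_soliton integral_soliton_sextic. Qed.

Lemma integral_dsoliton_sqr :
  (\int[mu]_(x in `[0%R, +oo[) (dsoliton x ^+ 2)%:E = (pi / 16)%:E)%E.
Proof.
have it2 := soliton_sqr_integrable; have it6 := soliton_sextic_integrable.
under eq_integral do rewrite dsoliton_sqr EFinM EFinB.
rewrite integralZl //; last exact: integrableB.
rewrite integralB_EFin // integral_soliton_sqr integral_soliton_sextic -EFinB -EFinM.
by congr EFin; field.
Qed.

Lemma tanh_ge0 x : 0 <= x -> 0 <= tanh x.
Proof.
move=> x0; rewrite divr_ge0 ?(ltW (den_gt0 x)) // subr_ge0 exprn_ege1 //.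
by apply: le_trans (expR_ge1Dx x); rewrite lerDl.
Qed.

Lemma soliton_le x y : 0 <= x -> x <= y -> soliton y <= soliton x.
Proof.
apply: ler0_derive1_nincry => [t _|t|]; first by have [] := is_derive_soliton t.
- rewrite in_itv /= andbT derive1E => t0; have [_ ->] := is_derive_soliton t.
  rewrite /dsoliton oppr_le0 mulr_ge0 ?invr_ge0 //.
  by rewrite mulr_ge0 ?tanh_ge0 ?(ltW t0) ?(ltW (soliton_gt0 t)).
- exact/continuous_subspaceT/continuous_soliton.
Qed.

Lemma soliton_le1 x : 0 <= x -> soliton x <= 1.
Proof.
move=> x0; apply: le_trans (soliton_le (lexx 0) x0) _.
by rewrite /soliton /sech expR0 expr1n mulr1 divff ?sqrtr1.
Qed.

Lemma soliton_cvg_pinfty : soliton x @[x --> +oo] --> (0 : R).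
Proof.
rewrite -(sqrtr0 R); apply: (@cvg_comp _ _ _ sech Num.sqrt); first exact: sech_cvg_pinfty.
exact: sqrt_continuous.
Qed.

Lemma d2soliton_sqr_le x : 0 <= x -> d2soliton x ^+ 2 <= 4^-1 * soliton x ^+ 2.
Proof.
move=> x0; have s0 := soliton_gt0 x; have s1 := soliton_le1 x0.
have -> : d2soliton x ^+ 2 = soliton x ^+ 2 * (4^-1 - 3 / 4 * soliton x ^+ 4) ^+ 2.
  by rewrite /d2soliton; ring.
rewrite mulrC ler_wpM2r ?sqr_ge0 //.
have := exprn_ge0 4 (ltW s0); have := exprn_ile1 4 (ltW s0) s1.
set y := soliton x ^+ 4; nra.
Qed.

End Soliton.

(** * Trial functions *)

Section AffineSubstitution.
Context {R : realType}.
Local Notation mu := (@lebesgue_measure R).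
Variables (h : R -> R) (s c : R).
Hypotheses (ch : continuous h) (h0 : forall x, 0 <= h x) (s0 : 0 < s).

Lemma derive1_affine a k : derive1 (fun x : R => a + k * x) = cst k.
Proof.
by apply/funext => x; rewrite derive1E; apply: derive_val; apply: is_derive_eq;
  rewrite /GRing.scale /=; ring.
Qed.

Lemma continuous_affine a k : continuous (fun x : R => a + k * x).
Proof.
by move=> x; apply: cvgD; [exact: cvg_cst|apply: cvgM; [exact: cvg_cst|exact: cvg_id]].
Qed.

Lemma derivable_affine a k x y : derivable_oo_LRcontinuous (fun t : R => a + k * t) x y.
Proof.
split=> [t _||]; first exact: ex_derive.
  exact/cvg_at_right_filter/continuous_affine.
exact/cvg_at_left_filter/continuous_affine.
Qed.

Lemma ge0_integral_scale (D : set R) (f : R -> R) k : measurable D -> measurable_fun D f ->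
  (forall x, 0 <= f x) -> 0 < k ->
  (\int[mu]_(x in D) (f x)%:E = k^-1%:E * \int[mu]_(x in D) (f x * k)%:E)%E.
Proof.
move=> mD mf f0 k0; rewrite -ge0_integralZl_EFin ?invr_ge0 ?ltW //.
- by apply: eq_integral => x _; rewrite -EFinM mulrC mulfK ?lt0r_neq0.
- by move=> x _; rewrite lee_fin mulr_ge0 // ltW.
- by apply/measurable_EFinP; apply: measurable_funM.
Qed.

Let measurable_h a k (D : set R) : measurable D -> measurable_fun D (fun x => h (a + k * x)).
Proof.
move=> mD; apply: measurable_funTS; apply: continuous_measurable_fun => x.
apply: continuous_comp; [exact: continuous_affine|exact: ch].
Qed.

Lemma ge0_integral_seg_affine l : 0 <= l ->
  (\int[mu]_(x in `[0%R, l]) (h (c + s * x)%R)%:E =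
   s^-1%:E * \int[mu]_(x in `[c, (c + s * l)%R]) (h x)%:E)%E.
Proof.
move=> l0; rewrite (ge0_integral_scale (k := s)) //; last exact: measurable_h.
congr (_ * _)%E.
have := @integration_by_substitution_increasing R (fun x => c + s * x) h 0 l l0.
rewrite derive1_affine mulr0 addr0 => -> //.
- by move=> x y _ _ xy; rewrite ltrD2l ltr_pM2l.
- by move=> x _; exact: cvg_cst.
- exact: is_cvg_cst.
- exact: is_cvg_cst.
- exact: derivable_affine.
- exact: continuous_subspaceT.
Qed.

Lemma ge0_integral_seg_affineN l : 0 <= l ->
  (\int[mu]_(x in `[0%R, l]) (h (c + s * l + - s * x)%R)%:E =
   s^-1%:E * \int[mu]_(x in `[c, (c + s * l)%R]) (h x)%:E)%E.
Proof.
move=> l0; rewrite (ge0_integral_scale (k := s)) //; last exact: measurable_h.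
congr (_ * _)%E.
have := @integration_by_substitution_decreasing R (fun x => c + s * l + - s * x) h 0 l l0.
rewrite derive1_affine mulr0 addr0 mulNr addrK => -> //.
- by apply: eq_integral => x _; rewrite /= opprK.
- by move=> x y _ _ xy; rewrite ltrD2l ltr_nM2l // oppr_lt0.
- by move=> x _; exact: cvg_cst.
- exact: is_cvg_cst.
- exact: is_cvg_cst.
- exact: derivable_affine.
- exact: continuous_subspaceT.
Qed.

Lemma ge0_integral_itvcy_affine :
  (\int[mu]_(x in `[0%R, +oo[) (h (c + s * x)%R)%:E =
   s^-1%:E * \int[mu]_(x in `[c, +oo[) (h x)%:E)%E.
Proof.
rewrite (ge0_integral_scale (k := s)) //; last exact: measurable_h.
congr (_ * _)%E.
have := @increasing_ge0_integration_by_substitutiony R (fun x => c + s * x) h 0.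
rewrite derive1_affine mulr0 addr0 => -> //.
- by move=> x y _ _ xy; rewrite ltrD2l ltr_pM2l.
- by move=> x _; exact: cvg_cst.
- exact: is_cvg_cst.
- exact: is_cvg_cst.
- by split=> [t _|]; [exact: ex_derive|exact/cvg_at_right_filter/continuous_affine].
- apply/cvgryPge => d; near=> x.
  by rewrite -lerBlDl mulrC -ler_pdivrMr.
- exact: continuous_subspaceT.
Unshelve. all: end_near.
Qed.

Lemma ge0_integral_itvcy_cat d : c <= d ->
  (\int[mu]_(x in `[c, +oo[) (h x)%:E =
   \int[mu]_(x in `[c, d]) (h x)%:E + \int[mu]_(x in `[d, +oo[) (h x)%:E)%E.
Proof.
move=> cd; have mh (D : set R) : measurable_fun D (EFin \o h).
  by apply/measurable_EFinP; apply: measurable_funTS; exact: continuous_measurable_fun.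
have -> : `[c, +oo[%classic = `[c, d] `|` `]d, +oo[ :> set R.
  by rewrite -itv_bndbnd_setU ?bnd_simp.
rewrite ge0_integral_setU ?(@integral_itv_obnd_cbnd _ d) //.
- exact: mh.
- by move=> x _; rewrite lee_fin.
- apply/disj_setPS => x [] /=; rewrite !in_itv /= => /andP[_ xd].
  by rewrite andbT ltNge xd.
Qed.

End AffineSubstitution.

Lemma integral_seg_derive (R : realType) (F f : R -> R) (x y : R) : x <= y ->
  (forall t, is_derive t (1 : R) F (f t)) -> continuous f ->
  (\int[lebesgue_measure]_(t in `[x, y]) (f t)%:E = (F y - F x)%:E)%E.
Proof.
rewrite le_eqVlt => /predU1P[<-|xy] dF cf; first by rewrite set_itv1 integral_set1 subrr.
have cF := is_derive_continuous dF.
rewrite (continuous_FTC2 xy (F := F)) ?EFinB //.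
- exact: continuous_subspaceT.
- split=> [t _||]; first by have [] := dF t.
    exact: cvg_at_right_filter (cF x).
  exact: cvg_at_left_filter (cF y).
- by move=> t _; rewrite derive1E; have [_ ->] := dF t.
Qed.

Section Unfolding.
Context {R : realType} {G : graph R}.
Local Notation mu := (@lebesgue_measure R).
Variable s : R.
Hypotheses (wf : wf_graph G) (s0 : 0 < s).
Implicit Types (e : 'I_(nE G)) (v w : 'I_(nV G)) (L : seq 'I_(nE G)).
Implicit Types (pos : 'I_(nV G) -> R) (h : R -> R) (x c : R).

Definition slope pos e : R := if bnd G e && (pos (tgt G e) < pos (src G e)) then - s else s.

(* The edges are laid on the line, their vertices at the coordinates [pos]. *)
Definition unfold pos e x : R := pos (src G e) + slope pos e * x.

Definition isometric pos L : Prop :=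
  forall e, e \in L -> bnd G e -> `|pos (tgt G e) - pos (src G e)| = s * len G e.

Lemma slope_sqr pos e : slope pos e ^+ 2 = s ^+ 2.
Proof. by rewrite /slope; case: ifP; rewrite ?sqrrN. Qed.

Lemma unfold0 pos e : unfold pos e 0 = pos (src G e).
Proof. by rewrite /unfold mulr0 addr0. Qed.

Lemma unfold_len pos L e : isometric pos L -> e \in L -> bnd G e ->
  unfold pos e (len G e) = pos (tgt G e).
Proof.
move=> iso eL be; have := iso e eL be; rewrite /unfold /slope be /=.
case: ltP => [lt_ts|le_st]; last by rewrite ger0_norm ?subr_ge0 // => <-; rewrite addrC subrK.
by rewrite ltr0_norm ?subr_lt0 // opprB mulNr => <-; rewrite opprB addrC subrK.
Qed.

Lemma eq_unfold pos pos' e : (forall v, touches e v -> pos v = pos' v) ->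
  unfold pos e =1 unfold pos' e.
Proof.
move=> eqp x; rewrite /unfold /slope (eqp _ (touches_src e)).
by case: (boolP (bnd G e)) => //= be; rewrite (eqp _ (touches_tgt be)).
Qed.

Lemma integral_unfold_half pos e h : continuous h -> (forall x, 0 <= h x) -> ~~ bnd G e ->
  (\int[mu]_(x in edge_dom G e) (h (unfold pos e x))%:E =
   s^-1%:E * \int[mu]_(x in `[pos (src G e), +oo[) (h x)%:E)%E.
Proof.
move=> ch h0 /negbTE be; rewrite /edge_dom be -ge0_integral_itvcy_affine //.
by rewrite /unfold /slope be.
Qed.

Lemma integral_unfold_joins pos e v w h : continuous h -> (forall x, 0 <= h x) ->
  joins e v w -> pos w = pos v + s * len G e ->
  (\int[mu]_(x in edge_dom G e) (h (unfold pos e x))%:E =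
   s^-1%:E * \int[mu]_(x in `[pos v, pos w]) (h x)%:E)%E.
Proof.
move=> ch h0 /joinsP[be ends] pw; have l0 := wf be.
have vw : pos v < pos w by rewrite pw ltrDl mulr_gt0.
rewrite /edge_dom be pw /unfold /slope be; case: ends => -[-> ->] /=.
  by rewrite (lt_gtF vw) ge0_integral_seg_affine // ltW.
by rewrite vw pw ge0_integral_seg_affineN // ltW.
Qed.

Lemma joins_isometric pos e v w : joins e v w -> pos w = pos v + s * len G e ->
  isometric pos [:: e].
Proof.
move=> /joinsP[be ends] pw e'; rewrite inE => /eqP -> _.
have sl0 : 0 <= s * len G e by rewrite mulr_ge0 ?ltW // wf.
have wv : `|pos w - pos v| = s * len G e by rewrite pw addrC addKr ger0_norm.
by case: ends => -[-> ->]; rewrite ?wv // distrC.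
Qed.

Lemma spath_unfold v L c : spath v L -> exists pos, [/\ pos v = c, isometric pos L &
  forall h, continuous h -> (forall x, 0 <= h x) ->
    (\sum_(e <- L) \int[mu]_(x in edge_dom G e) (h (unfold pos e x))%:E =
     s^-1%:E * \int[mu]_(x in `[c, +oo[) (h x)%:E)%E].
Proof.
move=> pL; elim: pL c => [e be|e {}v w {}L ej pL IH nv] c.
  exists (fun=> c); split=> // [e'|h ch h0].
    by rewrite inE => /eqP ->; rewrite (negbTE be).
  by rewrite big_seq1 integral_unfold_half.
have [pos [pw iso tile]] := IH (c + s * len G e).
pose pos' w' := if w' == v then c else pos w'.
have off_v e' : e' \in L -> ~~ touches e' v.
  by move=> e'L; apply: contra nv; exact: visits_touches.
have pos'E e' w' : e' \in L -> touches e' w' -> pos' w' = pos w'.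
  by move=> e'L; rewrite /pos'; case: eqP => // ->; rewrite (negbTE (off_v _ e'L)).
have pv : pos' v = c by rewrite /pos' eqxx.
have pos'w : pos' w = pos' v + s * len G e.
  have wv : w != v by apply: contra nv => /eqP <-; exact: spath_visits pL.
  by rewrite pv /pos' (negbTE wv).
have /andP[be _] := ej.
exists pos'; split=> // [e'|h ch h0].
  rewrite inE => /predU1P[->|e'L] be'; first exact: joins_isometric ej pos'w _ (mem_head _ _) be.
  by rewrite !(pos'E e') ?touches_src ?touches_tgt //; exact: iso.
rewrite big_cons (integral_unfold_joins ch h0 ej pos'w) pos'w pv.
have -> : (\sum_(e' <- L) \int[mu]_(x in edge_dom G e') (h (unfold pos' e' x))%:E =
    \sum_(e' <- L) \int[mu]_(x in edge_dom G e') (h (unfold pos e' x))%:E)%E.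
  apply: eq_big_seq => e' e'L; apply: eq_integral => x _.
  by rewrite (@eq_unfold pos' pos) // => w'; exact: pos'E.
rewrite tile // -ge0_muleDr ?integral_ge0 //; try by move=> x _; rewrite lee_fin.
by rewrite -ge0_integral_itvcy_cat // lerDl mulr_ge0 ?ltW // wf.
Qed.

End Unfolding.

Section PlacedTrial.
Context {R : realType} {G : graph R}.
Local Notation mu := (@lebesgue_measure R).
Implicit Types (e : 'I_(nE G)) (v w : 'I_(nV G)) (L : seq 'I_(nE G)).
Implicit Types (pos : 'I_(nV G) -> R) (u du : 'I_(nE G) -> R -> R).

(* [A], [B] and [C] are the integrals of the square of a profile, of the square of its
   derivative and of its sixth power; the functions are its dilations of speed [s] with
   the mass fixed, multiplied by [k]. *)
Definition dilated_trials (s A B C : R) : Prop := forall k : R, exists u du,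
  [/\ is_H1 G u du, mass G u = (k ^+ 2 * A)%:E,
      Lp_pow G 2 du = (k ^+ 2 * s ^+ 2 * B)%:E & Lp_pow G 6 u = (k ^+ 6 * s ^+ 2 * C)%:E].

Lemma continuous_unfold s pos e (f : R -> R) : continuous f ->
  continuous (fun x => f (unfold s pos e x)).
Proof.
by move=> cf x; apply: (@continuous_comp _ _ _ (unfold s pos e) f);
  [exact: continuous_affine|exact: cf].
Qed.

Lemma edge_integral_le_Lp_pow n u e : ~~ odd n ->
  (\int[mu]_(x in edge_dom G e) (u e x ^+ n)%:E <= Lp_pow G n u)%E.
Proof.
move=> evn; under eq_integral do rewrite -normr_even_pow //; rewrite /Lp_pow (bigD1 e) //=.
by rewrite leeDl // sume_ge0 // => e' _; apply: integral_ge0 => x _; rewrite lee_fin exprn_ge0.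
Qed.

Lemma Lp_pow_supported (s : R) pos L n (c : 'I_(nE G) -> R) (f : R -> R) (r J : R) :
  ~~ odd n -> (0 < n)%N -> uniq L -> continuous f -> 0 <= r -> (forall e, c e ^+ n = r) ->
  (\sum_(e <- L) \int[mu]_(x in edge_dom G e) (f (unfold s pos e x) ^+ n)%:E = J%:E)%E ->
  Lp_pow G n (fun e x => if e \in L then c e * f (unfold s pos e x) else 0) = (r * J)%:E.
Proof.
move=> evn n0 uL cf r0 cr EJ; rewrite /Lp_pow (bigID (mem L)) /= [X in (_ + X)%E]big1 ?adde0.
  rewrite EFinM -EJ ge0_sume_distrr; last first.
    by move=> e _; apply: integral_ge0 => x _; rewrite lee_fin exprn_even_ge0.
  rewrite -big_uniq //; apply: eq_big_seq => e eL.
  rewrite -ge0_integralZl_EFin //.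
  - by apply: eq_integral => x _; rewrite eL normr_even_pow // exprMn cr EFinM.
  - exact: measurable_edge_dom.
  - by move=> x _; rewrite lee_fin exprn_even_ge0.
  - apply/measurable_EFinP; apply: measurable_funTS; apply: continuous_measurable_fun.
    exact: (@continuousX _ (fun x => f (unfold s pos e x))) (continuous_unfold cf).
move=> e /negbTE eL; under eq_integral do rewrite eL normr0 expr0n (gtn_eqF n0).
by rewrite integral0.
Qed.

Section Placement.
Variables (s : R) (F dF : R -> R) (pos : 'I_(nV G) -> R) (L : seq 'I_(nE G)).
Hypotheses (s0 : 0 < s) (FdF : forall x, is_derive x (1 : R) F (dF x)) (cdF : continuous dF).
Hypotheses (uL : uniq L) (iso : isometric s pos L)
  (out0 : forall e v, e \notin L -> touches e v -> visits L v -> F (pos v) = 0).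

Definition placed (a : R) e x : R := if e \in L then a * F (unfold s pos e x) else 0.

Definition dplaced (a : R) e x : R :=
  if e \in L then a * slope s pos e * dF (unfold s pos e x) else 0.

Let cF : continuous F := is_derive_continuous FdF.

Lemma placed_continuous a e : continuous (placed a e).
Proof.
rewrite /placed; case: (e \in L) => x; last exact: cvg_cst.
by apply: cvgM; [exact: cvg_cst|exact: continuous_unfold].
Qed.

Lemma dplaced_continuous a e : continuous (dplaced a e).
Proof.
rewrite /dplaced; case: (e \in L) => x; last exact: cvg_cst.
by apply: cvgM; [exact: cvg_cst|exact: continuous_unfold].
Qed.

Lemma is_derive_placed a e x : is_derive x (1 : R) (placed a e) (dplaced a e x).
Proof.
rewrite /placed /dplaced; case: (e \in L); last exact: is_derive_cst.
by apply: is_derive_eq; rewrite /GRing.scale /=; ring.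
Qed.

Lemma placed_is_H1 a : (mass G (placed a) < +oo)%E -> (Lp_pow G 2 (dplaced a) < +oo)%E ->
  is_H1 G (placed a) (dplaced a).
Proof.
move=> mass_fin kin_fin.
have measurable_edge (f : R -> R) e : continuous f -> measurable_fun (edge_dom G e) f.
  by move=> cf; apply: measurable_funTS; exact: continuous_measurable_fun.
split; first by move=> e; apply: measurable_edge; exact: placed_continuous.
split; first by move=> e; apply: measurable_edge; exact: dplaced_continuous.
split; first by move=> e; exact: le_lt_trans (edge_integral_le_Lp_pow _ e (n := 2) isT) mass_fin.
split; first by move=> e; exact: le_lt_trans (edge_integral_le_Lp_pow _ e (n := 2) isT) kin_fin.
split=> [e x /edge_domP[x0 _]|].
  apply: integral_seg_derive x0 _ _; last exact: dplaced_continuous.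
  by move=> t; exact: is_derive_placed.
exists (fun v => if visits L v then a * F (pos v) else 0) => e; rewrite /placed.
have [eL|eL] := boolP (e \in L).
  rewrite unfold0 (visits_touches eL (touches_src e)); split=> // be.
  by rewrite (visits_touches eL (touches_tgt be)) (unfold_len iso).
have off v : touches e v -> (if visits L v then a * F (pos v) else 0) = 0.
  by move=> ev; case: ifP => // vL; rewrite (out0 eL ev vL) mulr0.
by split=> [|be]; rewrite off ?touches_src ?touches_tgt.
Qed.

Lemma placed_trials (A B C : R) :
  (\sum_(e <- L) \int[mu]_(x in edge_dom G e) (F (unfold s pos e x) ^+ 2)%:E
     = (s^-1 * A)%:E)%E ->
  (\sum_(e <- L) \int[mu]_(x in edge_dom G e) (dF (unfold s pos e x) ^+ 2)%:E
     = (s^-1 * B)%:E)%E ->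
  (\sum_(e <- L) \int[mu]_(x in edge_dom G e) (F (unfold s pos e x) ^+ 6)%:E
     = (s^-1 * C)%:E)%E ->
  dilated_trials s A B C.
Proof.
move=> EA EB EC k; pose a := k * Num.sqrt s; have s_neq0 := lt0r_neq0 s0.
have a2 : a ^+ 2 = k ^+ 2 * s by rewrite exprMn sqr_sqrtr // ltW.
have da2 e : (a * slope s pos e) ^+ 2 = a ^+ 2 * s ^+ 2 by rewrite exprMn slope_sqr.
have Em := Lp_pow_supported (n := 2) isT isT uL cF (sqr_ge0 a) (fun=> erefl (a ^+ 2)) EA.
have Eq := Lp_pow_supported (n := 2) isT isT uL cdF (mulr_ge0 (sqr_ge0 a) (sqr_ge0 s)) da2 EB.
have a6 : 0 <= a ^+ 6 by rewrite exprn_even_ge0.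
have Ew := Lp_pow_supported (n := 6) isT isT uL cF a6 (fun=> erefl (a ^+ 6)) EC.
exists (placed a), (dplaced a); split.
- by apply: placed_is_H1; rewrite ?/mass ?Em ?Eq ltry.
- by rewrite /mass Em a2 mulrA mulfK.
- by rewrite Eq a2; congr EFin; field.
- by rewrite Ew (exprM a 2 3) a2; congr EFin; field.
Qed.

End Placement.
End PlacedTrial.

Section DominatedIntegrals.
Context {R : realType}.
Local Notation mu := (@lebesgue_measure R).
Implicit Types (f g : R -> R) (D : set R) (a b r : R).

Lemma continuous_integral_fin D f g r : measurable D -> continuous f -> continuous g ->
  (forall x, D x -> 0 <= f x <= g x) -> (\int[mu]_(x in D) (g x)%:E = r%:E)%E ->
  exists t, (\int[mu]_(x in D) (f x)%:E = t%:E)%E.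
Proof.
move=> mD cf cg fg Er.
have mf (h : R -> R) : continuous h -> measurable_fun D (EFin \o h).
  by move=> ch; apply/measurable_EFinP/measurable_funTS; exact: continuous_measurable_fun.
exists (fine (\int[mu]_(x in D) (f x)%:E)%E); rewrite fineK // ge0_fin_numE.
  apply: (@le_lt_trans _ _ r%:E); rewrite ?ltry // -Er.
  apply: ge0_le_integral => //; try exact: mf; move=> x /fg /andP[f0 fgx]; rewrite lee_fin //.
by apply: integral_ge0 => x /fg /andP[f0 _]; rewrite lee_fin.
Qed.

Lemma continuous_pow_integrable n a b f : continuous f ->
  mu.-integrable `[a, b]%classic (EFin \o (fun x => f x ^+ n)).
Proof. by move=> cf; exact/continuous_seg_integrable/continuous_subspaceT/continuousX. Qed.

Lemma integral_seg_Lpow n a b f : continuous f ->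
  (\int[mu]_(x in `[a, b]) (f x ^+ n)%:E = (Lpow n `[a, b] f)%:E)%E.
Proof.
move=> cf; rewrite /Lpow /Rintegral fineK //.
exact: (@integrable_fin_num _ _ _ mu _ (measurable_itv _) _ (continuous_pow_integrable n a b cf)).
Qed.

Lemma Lpow_seg_mono n m a b f g : continuous f -> continuous g ->
  (forall x, a <= x <= b -> f x ^+ n <= g x ^+ m) -> Lpow n `[a, b] f <= Lpow m `[a, b] g.
Proof.
by move=> cf cg fg; apply: le_Rintegral => //; exact: continuous_pow_integrable.
Qed.

End DominatedIntegrals.

Lemma bernoulli_sub (R : realDomainType) (y d : R) n : 0 <= d -> d <= y ->
  y ^+ n.+1 - n.+1%:R * d * y ^+ n <= (y - d) ^+ n.+1.
Proof.
move=> d0 dy; have y0 := le_trans d0 dy; elim: n => [|n IHn].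
  by rewrite !expr1 expr0 mulr1 mul1r.
have yd0 : 0 <= y - d by rewrite subr_ge0.
rewrite [leRHS]exprS; apply: le_trans (ler_wpM2l yd0 IHn).
rewrite -subr_ge0 (_ : _ - _ = n.+1%:R * d ^+ 2 * y ^+ n).
  by rewrite mulr_ge0 ?exprn_ge0 // mulr_ge0 ?sqr_ge0.
by rewrite -(natr1 n.+1) (exprS y n.+1) (exprS y n); ring.
Qed.

Section SolitonTrials.
Context {R : realType} {G : graph R}.
Local Notation mu := (@lebesgue_measure R).
Hypothesis wf : wf_graph G.
Implicit Types (e : 'I_(nE G)) (v w : 'I_(nV G)) (L : seq 'I_(nE G)) (s eps T A B C : R).

Lemma spath_trials v L (F dF : R -> R) A B C s : spath v L -> 0 < s ->
  (forall x, is_derive x (1 : R) F (dF x)) -> continuous dF ->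
  (forall e w, e \notin L -> touches e w -> visits L w -> w = v /\ F 0 = 0) ->
  (\int[mu]_(x in `[0%R, +oo[) (F x ^+ 2)%:E = A%:E)%E ->
  (\int[mu]_(x in `[0%R, +oo[) (dF x ^+ 2)%:E = B%:E)%E ->
  (\int[mu]_(x in `[0%R, +oo[) (F x ^+ 6)%:E = C%:E)%E ->
  @dilated_trials R G s A B C.
Proof.
move=> pL s0 FdF cdF out EA EB EC; have cF := is_derive_continuous FdF.
have [pos [pv iso tile]] := spath_unfold wf s0 0 pL.
have tileX n (f : R -> R) (r : R) : ~~ odd n -> continuous f ->
    (\int[mu]_(x in `[0%R, +oo[) (f x ^+ n)%:E = r%:E)%E ->
    (\sum_(e <- L) \int[mu]_(x in edge_dom G e) (f (unfold s pos e x) ^+ n)%:E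
      = (s^-1 * r)%:E)%E.
  move=> evn cf Er; rewrite (tile (fun x => f x ^+ n)) ?Er ?EFinM //; first exact: continuousX.
  by move=> x; exact: exprn_even_ge0.
apply: (placed_trials s0 FdF cdF (spath_uniq pL) iso); try exact: tileX.
move=> e w eL ew wL.
by have [-> F0] := out e w eL ew wL; rewrite pv.
Qed.

Lemma spath_all_trials v L s : spath v L -> (forall e, e \in L) -> 0 < s ->
  @dilated_trials R G s (pi / 2) (pi / 16) (pi / 4).
Proof.
move=> pL allL s0; apply: (spath_trials pL s0 (@is_derive_soliton R)).
- exact: continuous_dsoliton.
- by move=> e w; rewrite allL.
- exact: integral_soliton_sqr.
- exact: integral_dsoliton_sqr.
- exact: integral_soliton_sextic.
Qed.

(* The derivative of the soliton vanishes at [0], so that it can be placed on any halfline. *)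
Lemma halfline_trials : noncompact G ->
  exists B C, forall s, 0 < s -> @dilated_trials R G s (pi / 16) B C.
Proof.
move=> [e be]; have sol_le1 := @soliton_le1 R; have sol_gt0 := @soliton_gt0 R.
have cd2 : continuous (@d2soliton R).
  move=> x; apply: cvgB; apply: cvgM; try exact: cvg_cst; first exact: continuous_soliton.
  exact: continuousX (@continuous_soliton R) x.
have csX n := continuousX (n := n) (@continuous_soliton R).
have cdX n := continuousX (n := n) (@continuous_dsoliton R).
have [x|B EB] := continuous_integral_fin (measurable_itv `[0%R, +oo[)
  (continuousX (n := 2) cd2) (csX 2) _ integral_soliton_sqr.
  rewrite /= in_itv /= andbT => x0; rewrite sqr_ge0 /=.
  by apply: le_trans (d2soliton_sqr_le x0) _; have := sqr_ge0 (soliton x); lra.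
have [x|C EC] := continuous_integral_fin (measurable_itv `[0%R, +oo[)
  (cdX 6) (cdX 2) _ integral_dsoliton_sqr.
  rewrite /= in_itv /= andbT => x0; rewrite exprn_even_ge0 //= (exprM _ 2 3).
  have d0 := sqr_ge0 (dsoliton x); rewrite exprS ler_piMr // exprn_ile1 //.
  have s2 := exprn_ile1 2 (ltW (sol_gt0 x)) (sol_le1 x x0).
  rewrite dsoliton_sqr; have := exprn_ge0 6 (ltW (sol_gt0 x)); lra.
exists B, C => s s0; apply: (spath_trials (spath_half be) s0 (@is_derive_dsoliton R)) => //.
- move=> e' w _ _; rewrite /visits /= orbF touches_half // => /eqP ->.
  by rewrite /dsoliton tanh0 mul0r mulr0 oppr0.
- exact: integral_dsoliton_sqr.
Qed.

Definition cut_soliton T x : R := soliton x - soliton T.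

Lemma continuous_cut_soliton T : continuous (cut_soliton T).
Proof. by move=> x; apply: cvgB; [exact: continuous_soliton|exact: cvg_cst]. Qed.

Lemma cut_soliton_trials v e s : degree G v = 1%N -> touches e v -> bnd G e -> 0 < s ->
  let T := s * len G e in
  @dilated_trials R G s (Lpow 2 `[0, T] (cut_soliton T)) (Lpow 2 `[0, T] dsoliton)
    (Lpow 6 `[0, T] (cut_soliton T)).
Proof.
move=> dv ev be s0 T; have [w ej] : exists w, joins e v w.
  case/orP: ev => [/eqP <-|/andP[_ /eqP <-]]; first by exists (tgt G e); rewrite /joins be !eqxx.
  by exists (src G e); rewrite /joins be !eqxx orbT.
have wv : w != v.
  have := degree1_edge_deg dv ev; apply: contra_eqN => /eqP wv.
  by rewrite /edge_deg; case/joinsP: ej => be' [] [-> ->]; rewrite be' wv eqxx.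
pose pos v' := if v' == v then 0 else T.
have pv : pos v = 0 by rewrite /pos eqxx.
have pw : pos w = T by rewrite /pos (negbTE wv).
have pwv : pos w = pos v + s * len G e by rewrite pv pw add0r.
have ccut := @continuous_cut_soliton T.
have dcut x : is_derive x (1 : R) (cut_soliton T) (dsoliton x).
  by have ds := is_derive_soliton x; apply: is_derive_eq; rewrite subr0.
have iso := joins_isometric wf s0 ej pwv.
have value n (f : R -> R) : ~~ odd n -> continuous f ->
    (\sum_(e' <- [:: e]) \int[mu]_(x in edge_dom G e') (f (unfold s pos e' x) ^+ n)%:E
      = (s^-1 * Lpow n `[0, T] f)%:E)%E.
  move=> evn cf; rewrite big_seq1 EFinM -integral_seg_Lpow //.
  rewrite (integral_unfold_joins wf s0 (h := fun x => f x ^+ n) _ _ ej pwv) ?pv ?pw //.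
    exact: continuousX.
  by move=> x; exact: exprn_even_ge0.
apply: (placed_trials s0 dcut (@continuous_dsoliton R) (erefl : uniq [:: e]) iso).
- move=> e' w'; rewrite inE => e'e e'w'; rewrite /visits /= orbF (touches_joins _ ej).
  case/predU1P=> [w'v|/eqP ->]; last by rewrite pw /cut_soliton subrr.
  by rewrite w'v in e'w'; rewrite (degree1_touches dv ev e'w') eqxx in e'e.
- exact: value.
- exact: value (@continuous_dsoliton R).
- exact: value.
Qed.

Lemma Lpow_seg_le_itvcy (f : R -> R) n T r : ~~ odd n -> continuous f ->
  (\int[mu]_(x in `[0%R, +oo[) (f x ^+ n)%:E = r%:E)%E -> Lpow n `[0, T] f <= r.
Proof.
move=> evn cf Er; rewrite (_ : r = Lpow n `[0, +oo[ f); last by rewrite /Lpow /Rintegral Er.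
apply: Lpow_subset => //; first exact: subset_itvl.
exact: even_pow_integrable Er.
Qed.

Lemma cut_soliton_sextic_ge T : 0 <= T ->
  Lpow 6 `[0, T] (@soliton R) - 3 * pi * soliton T <= Lpow 6 `[0, T] (cut_soliton T).
Proof.
move=> T0; have cs := @continuous_soliton R; have sT0 := soliton_gt0 T.
have it_sol2 := continuous_pow_integrable 2 0 T cs.
have it_cut6 := continuous_pow_integrable 6 0 T (@continuous_cut_soliton T).
have mass_le : Lpow 2 `[0, T] (@soliton R) <= pi / 2.
  exact: Lpow_seg_le_itvcy (@integral_soliton_sqr R).
suff h : Lpow 6 `[0, T] (@soliton R) <=
    Lpow 6 `[0, T] (cut_soliton T) + 6 * soliton T * Lpow 2 `[0, T] (@soliton R).
  rewrite lerBlDr; apply: le_trans h _; rewrite lerD2l.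
  rewrite (_ : 3 * pi * soliton T = 6 * soliton T * (pi / 2)); last by field.
  by rewrite ler_wpM2l // mulr_ge0 // ltW.
have it_scaled := integrable_scalef (6 * soliton T) (measurable_itv _) it_sol2.
rewrite /Lpow -(RintegralZl _ _ it_sol2) // -RintegralD //.
apply: le_Rintegral => //; [exact: continuous_pow_integrable|exact: integrable_addf|].
move=> x; rewrite /= in_itv /= => /andP[x0 xT].
have := bernoulli_sub 5 (ltW sT0) (soliton_le x0 xT); rewrite -/(cut_soliton T x).
have : 6 * soliton T * soliton x ^+ 5 <= 6 * soliton T * soliton x ^+ 2.
  rewrite ler_wpM2l ?mulr_ge0 ?(ltW sT0) //.
  by rewrite ler_wiXn2l ?(ltW (soliton_gt0 x)) ?soliton_le1.
lra.
Qed.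

Definition near_optimal eps A B C : Prop :=
  [/\ C <= A, A <= pi / 2, B <= pi / 16 & pi / 4 - eps <= C].

Lemma cut_soliton_near_optimal eps : 0 < eps -> \forall T \near +oo,
  near_optimal eps (Lpow 2 `[0, T] (cut_soliton T)) (Lpow 2 `[0, T] dsoliton)
    (Lpow 6 `[0, T] (cut_soliton T)).
Proof.
move=> eps0; have cs := @continuous_soliton R.
have sextic_cvg : Lpow 6 `[0, T] (@soliton R) - 3 * pi * soliton T @[T --> +oo] --> (pi / 4 : R).
  rewrite -[X in _ --> X](subr0 (pi / 4)) -[X in _ - X](mulr0 (3 * pi)); apply: cvgB.
    have -> : pi / 4 = Lpow 6 `[0, +oo[ (@soliton R).
      by rewrite /Lpow /Rintegral integral_soliton_sextic.
    apply: Rintegral_itvcy_cvg (@soliton_sextic_integrable R) => t; exact: exprn_even_ge0.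
  by apply: cvgM; [exact: cvg_cst|exact: soliton_cvg_pinfty].
near=> T; have T0 : 0 <= T by near: T; apply: nbhs_pinfty_ge; exact: num_real.
have ccut := @continuous_cut_soliton T.
have cut_le x : 0 <= x <= T -> 0 <= cut_soliton T x <= soliton x.
  move=> /andP[x0 xT]; rewrite subr_ge0 soliton_le //=.
  by rewrite lerBlDr lerDl ltW // soliton_gt0.
split.
- apply: Lpow_seg_mono => // x xT; have /andP[c0 cle] := cut_le x xT.
  have /andP[x0 _] := xT.
  by rewrite ler_wiXn2l // (le_trans cle) // soliton_le1.
- apply: le_trans _ (Lpow_seg_le_itvcy (n := 2) T isT cs (@integral_soliton_sqr R)).
  apply: Lpow_seg_mono => // x /cut_le /andP[c0 cle].
  by rewrite ler_pXn2r ?nnegrE // (le_trans c0).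
- exact: Lpow_seg_le_itvcy (@continuous_dsoliton R) (@integral_dsoliton_sqr R).
- apply: le_trans (cut_soliton_sextic_ge T0); near: T.
  by apply: (cvgr_ge _ sextic_cvg); rewrite ltrBlDr ltrDl.
Unshelve. all: end_near.
Qed.

Lemma terminal_trials eps : connected_graph G -> noncompact G -> has_terminal_point G -> 0 < eps ->
  exists s0, forall s, s0 <= s -> 0 < s ->
    exists A B C, near_optimal eps A B C /\ @dilated_trials R G s A B C.
Proof.
move=> cG nG [v dv] eps0; have [L pL] := spath_exists v cG nG.
have /hasP[e _ ev] := spath_visits pL.
have [be|be] := boolP (bnd G e); last first.
  have [pe alle] := degree1_halfline_all cG dv ev be.
  exists 0 => s _ s0; exists (pi / 2), (pi / 16), (pi / 4).
  by split; [split=> //; have := pi_gt0 R; lra|exact: spath_all_trials pe alle s0].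
have [M [_ hM]] := cut_soliton_near_optimal eps0; have l0 := wf be.
exists ((M + 1) / len G e) => s; rewrite ler_pdivrMr // => Ms s0.
exists (Lpow 2 `[0, (s * len G e)] (cut_soliton (s * len G e))),
  (Lpow 2 `[0, (s * len G e)] dsoliton),
  (Lpow 6 `[0, (s * len G e)] (cut_soliton (s * len G e))).
split; last exact: cut_soliton_trials dv ev be s0.
by apply: hM; lra.
Qed.

End SolitonTrials.

(** * Critical mass and ground energy *)

Section CriticalMass.
Context {R : realType}.
Implicit Types (G : graph R) (eps A B C d m s : R).

Let pi_neq0 : pi != 0 :> R.
Proof. by rewrite lt0r_neq0 ?pi_gt0. Qed.

Definition mu_halfline : R := Num.sqrt 3 * pi / 4.

Lemma mu_halfline_gt0 : 0 < mu_halfline.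
Proof. by rewrite divr_gt0 // mulr_gt0 ?sqrtr_gt0 ?pi_gt0. Qed.

Lemma mu_halfline_sqr : mu_halfline ^+ 2 = 3 * pi ^+ 2 / 16.
Proof. by rewrite /mu_halfline !exprMn sqr_sqrtr //; field. Qed.

Lemma sharp_constant_mu_halfline : (pi / (4 * mu_halfline)) ^+ 2 = 3^-1.
Proof. by rewrite expr_div_n exprMn mu_halfline_sqr; move: (pi) pi_neq0 => p p0; field. Qed.

Lemma energyE G u du q w : Lp_pow G 2 du = q%:E -> Lp_pow G 6 u = w%:E ->
  energy G u du = (q / 2 - w / 6)%:E.
Proof. by move=> hq hw; rewrite /energy hq hw -!EFinM -EFinB; congr EFin; ring. Qed.

Lemma dilated_trials_energy G s A B C mu : @dilated_trials R G s A B C -> 0 < A -> 0 <= mu ->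
  exists u du, [/\ is_H1 G u du, mass G u = mu%:E &
    energy G u du = (s ^+ 2 * (mu / A * B / 2 - (mu / A) ^+ 3 * C / 6))%:E].
Proof.
move=> trials A0 mu0; have [u [du [hu Em Eq Ew]]] := trials (Num.sqrt (mu / A)).
have k2 : Num.sqrt (mu / A) ^+ 2 = mu / A by rewrite sqr_sqrtr // divr_ge0 // ltW.
exists u, du; split=> //; first by rewrite Em k2 divfK // lt0r_neq0.
rewrite (energyE Eq Ew) (exprM _ 2 3) k2; congr EFin; field.
by rewrite lt0r_neq0.
Qed.

(* The excess is positive exactly when [m ^+ 2 > 3 / 4], that is when the mass
   [m * pi / 2] exceeds [mu_halfline]. *)
Lemma near_optimal_energy_le (m k2 eps A B C : R) (excess := m ^+ 2 * pi / 12 - pi / 16) :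
  0 < m -> m <= k2 -> 0 <= excess -> 0 <= C -> m ^+ 2 * eps / 3 <= excess / 2 ->
  near_optimal eps A B C -> k2 * B / 2 - k2 ^+ 3 * C / 6 <= - (m * excess / 4).
Proof.
move=> m0 mk D0 C0 epsD [_ _ B_le C_ge].
have m2C : m ^+ 2 * (pi / 4 - eps) <= k2 ^+ 2 * C.
  apply: (@le_trans _ _ (m ^+ 2 * C)); first by rewrite ler_wpM2l ?sqr_ge0.
  by rewrite ler_wpM2r // ler_pXn2r ?nnegrE ?(ltW m0) // (le_trans (ltW m0)).
have bracket : B - k2 ^+ 2 * C / 3 <= - (excess / 2) by rewrite /excess in epsD *; lra.
rewrite (_ : _ - _ = k2 / 2 * (B - k2 ^+ 2 * C / 3)); last by field.
apply: (@le_trans _ _ (k2 / 2 * - (excess / 2))).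
  by rewrite ler_wpM2l // divr_ge0 // (le_trans (ltW m0)).
have := ler_wpM2r D0 mk; lra.
Qed.

Section Graph.
Variable G : graph R.
Hypotheses (wf : wf_graph G) (cG : connected_graph G) (nG : noncompact G).

Lemma GN_ratio_le u du : is_H1 G u du -> mass G u != 0%E ->
  (GN_ratio G u du <= (16 / pi ^+ 2)%:E)%E.
Proof.
move=> hu mass_neq0; have [m Em m0] : exists2 m, mass G u = m%:E & 0 < m.
  have [Em _ _] := is_H1_Lp_powE wf hu; move: mass_neq0; rewrite Em eqe => m_neq0.
  eexists; first exact: erefl.
  rewrite lt_def m_neq0 -lee_fin -Em; apply: sume_ge0 => e _; apply: integral_ge0 => x _.
  by rewrite lee_fin exprn_ge0.
have [q [w [Eq Ew w0 wq _]]] := sharp_inequality wf cG nG hu Em m0.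
have b0 : 0 < (pi / (4 * m)) ^+ 2 by rewrite exprn_gt0 // divr_gt0 ?pi_gt0 ?mulr_gt0.
have q0 : 0 < q by apply: lt_le_trans wq; rewrite mulr_gt0.
rewrite /GN_ratio Eq Ew Em /= gt_eqF // lee_fin ler_pdivrMr ?mulr_gt0 ?exprn_gt0 //.
rewrite (_ : 16 / _ * _ = q / (pi / (4 * m)) ^+ 2); first by rewrite ler_pdivlMr // mulrC.
by move: (pi) pi_neq0 (lt0r_neq0 m0) => p p0 m_neq0; field; rewrite m_neq0 p0.
Qed.

Lemma energy_ge0 u du : is_H1 G u du -> mass G u = mu_halfline%:E ->
  (0 <= energy G u du)%E /\ (energy G u du = 0%E -> is_halfline G).
Proof.
move=> hu Em; have [q [w [Eq Ew w0 wq eq_half]]] := sharp_inequality wf cG nG hu Em mu_halfline_gt0.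
rewrite sharp_constant_mu_halfline in wq eq_half.
rewrite (energyE Eq Ew) lee_fin; split=> [|[E0]]; first by lra.
by apply: eq_half; lra.
Qed.

Lemma ground_energy_critical : ground_energy G mu_halfline = 0%E.
Proof.
apply/eqP; rewrite eq_le; apply/andP; split; last first.
  by apply: le_ereal_inf_tmp => _ [u [du [hu [Em ->]]]]; have [] := energy_ge0 hu Em.
apply/lee_addgt0Pr => d d0; rewrite add0e.
have [B [C trials]] := halfline_trials wf nG.
set A := pi / 16 in trials; have A0 : 0 < A by rewrite divr_gt0 ?pi_gt0.
pose c := `|mu_halfline / A * B / 2 - (mu_halfline / A) ^+ 3 * C / 6|.
have c1 : 0 < c + 1 by rewrite ltr_wpDl ?normr_ge0.
pose s := Num.min 1 (d / (c + 1)).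
have s0 : 0 < s by rewrite lt_min ltr01 divr_gt0.
have s1 : s <= 1 by rewrite ge_min lexx.
have sd : s * (c + 1) <= d by rewrite -ler_pdivlMr // ge_min lexx orbT.
have [u [du [hu Em Ee]]] := dilated_trials_energy (trials s s0) A0 (ltW mu_halfline_gt0).
apply: le_trans (ereal_inf_lbound _) _; first by exists u, du; split=> //; split.
rewrite Ee lee_fin; apply: le_trans (ler_wpM2l (sqr_ge0 s) (ler_norm _)) _; rewrite -/c.
apply: le_trans sd; apply: ler_pM; rewrite ?sqr_ge0 ?normr_ge0 ?lerDl //.
by rewrite expr2 ler_piMr // ltW.
Qed.

Section Terminal.
Hypothesis tG : has_terminal_point G.

Lemma near_optimal_gt0 eps A B C : eps < pi / 4 -> near_optimal eps A B C -> 0 < C <= A.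
Proof. by move=> eps_lt [CA _ _ C_ge]; rewrite CA andbT; lra. Qed.

Lemma K_const_ge eps : 0 < eps -> eps < pi / 4 ->
  ((64 / pi ^+ 3 * (pi / 4 - eps))%:E <= K_const G)%E.
Proof.
move=> eps0 eps_lt; have p0 := pi_gt0 R.
have [s0 trials] := terminal_trials wf cG nG tG eps0.
have [||A [B [C [opt trial]]]] := trials (Num.max 1 s0).
- by rewrite le_max lexx orbT.
- by rewrite lt_max ltr01.
set s := Num.max 1 s0 in trial; have s_gt0 : 0 < s by rewrite lt_max ltr01.
have /andP[C0 CA] := near_optimal_gt0 eps_lt opt; have A0 := lt_le_trans C0 CA.
have [_ A_le B_le C_ge] := opt; have [u [du [hu Em Eq Ew]]] := trial 1.
rewrite !expr1n !mul1r in Em Eq Ew.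
have B0 : 0 < B.
  have [q [w [Eq' Ew' w0 wq _]]] := sharp_inequality wf cG nG hu Em A0.
  have q0 : 0 < q.
    by apply: lt_le_trans wq; rewrite mulr_gt0 // exprn_gt0 // divr_gt0 // mulr_gt0.
  by move: q0; rewrite -lte_fin -Eq' Eq lte_fin pmulr_rgt0 // exprn_gt0.
apply: le_trans (ereal_sup_ubound _); last first.
  by exists u, du; split=> //; rewrite Em eqe gt_eqF.
have s2B : 0 < s ^+ 2 * B by rewrite mulr_gt0 ?exprn_gt0.
rewrite /GN_ratio Eq Ew Em /= gt_eqF // lee_fin.
rewrite [leRHS](_ : _ = C / (A ^+ 2 * B)); last by field; rewrite !lt0r_neq0.
rewrite ler_pdivlMr ?mulr_gt0 ?exprn_gt0 //; apply: le_trans C_ge.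
have AB : A ^+ 2 * B <= (pi / 2) ^+ 2 * (pi / 16).
  by apply: ler_pM; rewrite ?sqr_ge0 ?(ltW B0) // ler_pXn2r ?nnegrE ?(ltW A0) // divr_ge0 // ltW.
rewrite mulrAC -[leRHS]mul1r ler_wpM2r ?subr_ge0 ?(ltW eps_lt) //.
apply: le_trans (ler_wpM2l _ AB) _; first by rewrite divr_ge0 // exprn_ge0 // ltW.
by rewrite le_eqVlt; apply/orP; left; apply/eqP; move: (pi) pi_neq0 => p p_neq0; field.
Qed.

Lemma K_constE : K_const G = (16 / pi ^+ 2)%:E.
Proof.
have p0 := pi_gt0 R; apply/eqP; rewrite eq_le; apply/andP; split.
  by apply: ge_ereal_sup => _ [u [du [hu [hm ->]]]]; exact: GN_ratio_le.
apply/lee_addgt0Pr => d d0; pose eps := Num.min (pi / 8) (d * (pi ^+ 3 / 64)).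
have c0 : 0 < pi ^+ 3 / 64 :> R by rewrite divr_gt0 ?exprn_gt0.
have eps0 : 0 < eps by rewrite lt_min (divr_gt0 p0) // mulr_gt0.
have eps_lt : eps < pi / 4 by apply: (@le_lt_trans _ _ (pi / 8)); [rewrite ge_min lexx|lra].
have eps_le : eps / (pi ^+ 3 / 64) <= d by rewrite ler_pdivrMr // ge_min lexx orbT.
apply: le_trans (leeD2r _ (K_const_ge eps0 eps_lt)); rewrite -EFinD lee_fin.
rewrite (_ : 64 / _ * _ = 16 / pi ^+ 2 - eps / (pi ^+ 3 / 64)); first by lra.
by move: (eps) (pi) pi_neq0 => t p p_neq0; field.
Qed.

Lemma mu_critE : mu_crit G = mu_halfline.
Proof.
rewrite /mu_crit K_constE /= (_ : 3 / _ = mu_halfline ^+ 2).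
  by rewrite sqrtr_sqr ger0_norm // ltW // mu_halfline_gt0.
by rewrite mu_halfline_sqr; move: (pi) pi_neq0 => p p0; field.
Qed.

Lemma energy_unbounded mu : mu_halfline < mu -> exists c s0, 0 < c /\ forall s, s0 <= s -> 0 < s ->
  exists u du, [/\ is_H1 G u du, mass G u = mu%:E & (energy G u du <= (- (s ^+ 2 * c))%:E)%E].
Proof.
move=> mu_gt; have p0 := pi_gt0 R; have mu0 := lt_trans mu_halfline_gt0 mu_gt.
pose m := 2 * mu / pi; have m0 : 0 < m by rewrite divr_gt0 ?mulr_gt0.
pose excess := m ^+ 2 * pi / 12 - pi / 16; have excess0 : 0 < excess.
  have : mu_halfline ^+ 2 < mu ^+ 2 by rewrite ltr_pXn2r ?nnegrE ?ltW ?mu_halfline_gt0.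
  rewrite mu_halfline_sqr -subr_gt0 => mu2.
  rewrite (_ : excess = (mu ^+ 2 - 3 * pi ^+ 2 / 16) / (3 * pi)) ?divr_gt0 ?mulr_gt0 //.
  by rewrite /excess /m; move: (pi) pi_neq0 => p p_neq0; field.
pose eps := Num.min (pi / 8) (excess / 2 / (m ^+ 2 / 3)).
have m23 : 0 < m ^+ 2 / 3 by rewrite divr_gt0 ?exprn_gt0.
have eps0 : 0 < eps by rewrite lt_min (divr_gt0 p0) // divr_gt0 // divr_gt0.
have eps_lt : eps < pi / 4 by apply: (@le_lt_trans _ _ (pi / 8)); [rewrite ge_min lexx|lra].
have eps_le : m ^+ 2 * eps / 3 <= excess / 2.
  by rewrite mulrAC mulrC -ler_pdivlMr // ge_min lexx orbT.
have [s0 trials] := terminal_trials wf cG nG tG eps0.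
exists (m * excess / 4), s0; split=> [|s s0s s_gt0]; first by rewrite !mulr_gt0 ?invr_gt0.
have [A [B [C [opt trial]]]] := trials s s0s s_gt0.
have /andP[C0 CA] := near_optimal_gt0 eps_lt opt; have A0 := lt_le_trans C0 CA.
have [u [du [hu Em Ee]]] := dilated_trials_energy trial A0 (ltW mu0).
exists u, du; split=> //; rewrite Ee lee_fin -[leRHS]mulrN ler_wpM2l ?sqr_ge0 //.
have m_le : m <= mu / A.
  have [_ A_le _ _] := opt; rewrite /m ler_pdivrMr // mulrAC ler_pdivlMr //.
  have := ler_wpM2l (ltW mu0) A_le; lra.
exact: near_optimal_energy_le (ltW excess0) (ltW C0) eps_le opt.
Qed.

Lemma ground_energy_above mu : mu_halfline < mu -> ground_energy G mu = -oo%E.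
Proof.
move=> mu_gt; have [c [s0 [c0 trials]]] := energy_unbounded mu_gt.
apply: eq_ninfty => M; pose s := Num.max 1 (Num.max s0 (`|M| / c)).
have s1 : 1 <= s by rewrite le_max lexx.
have [||u [du [hu Em Ee]]] := trials s; first by rewrite !le_max lexx orbT.
  exact: lt_le_trans s1.
apply: le_trans (ereal_inf_lbound _) _; first by exists u, du; split=> //; split.
apply: le_trans Ee _; rewrite lee_fin lerNl; apply: le_trans (ler_norm _) _; rewrite normrN.
rewrite -ler_pdivrMr //; apply: (@le_trans _ _ s); first by rewrite !le_max lexx !orbT.
by rewrite expr2 ler_peMr // (le_trans ler01).
Qed.

Lemma halfline_attains : is_halfline G -> exists u du,
  [/\ is_H1 G u du, mass G u = mu_halfline%:E & energy G u du = 0%E].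
Proof.
move=> hG; have [v dv] := tG; have [L pL] := spath_exists v cG nG.
have allL := halfline_spath_all cG hG dv pL.
have p2 : 0 < pi / 2 :> R by rewrite divr_gt0 ?pi_gt0.
have trials := spath_all_trials wf pL allL ltr01.
have [u [du [hu Em Ee]]] := dilated_trials_energy trials p2 (ltW mu_halfline_gt0).
exists u, du; split=> //; rewrite Ee; congr EFin.
by rewrite expr1n mul1r exprS expr_div_n mu_halfline_sqr; move: (pi) pi_neq0 => p p0; field.
Qed.

End Terminal.

End Graph.

End CriticalMass.

Lemma halfline_graph_terminal (R : realType) : [/\ wf_graph (halfline_graph R),
  connected_graph (halfline_graph R), noncompact (halfline_graph R) &
  has_terminal_point (halfline_graph R)].
Proof.
split=> //; last by exists ord0; rewrite degreeE big_ord1.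
  by split=> // v w; rewrite (ord1 v) (ord1 w); exact: connect0.
by exists ord0.
Qed.

Theorem theorem7p1 (R : realType) (G : graph R) :
  wf_graph G -> connected_graph G -> noncompact G -> has_terminal_point G ->
  mu_crit G = mu_crit (halfline_graph R) /\
  (forall mu : R, mu_crit (halfline_graph R) < mu <= mu_crit (line_graph R) ->
     ground_energy G mu = -oo%E) /\
  ground_energy G (mu_crit (halfline_graph R)) = 0%E /\
  ((exists u du : 'I_(nE G) -> R -> R,
      is_H1 G u du /\ mass G u = (mu_crit (halfline_graph R))%:E /\
      energy G u du = ground_energy G (mu_crit (halfline_graph R)))
   <-> is_halfline G).
Proof.
move=> wf cG nG tG; have [wfh ch nh th] := halfline_graph_terminal R.
rewrite (mu_critE wf cG nG tG) (mu_critE wfh ch nh th) (ground_energy_critical wf cG nG).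
split=> //; split; first by move=> mu /andP[mu_gt _]; exact: ground_energy_above.
split=> //; split=> [[u [du [hu [Em E0]]]]|hG].
  by have [_] := energy_ge0 wf cG nG hu Em; exact.
have [u [du [hu Em E0]]] := halfline_attains wf cG nG tG hG.
by exists u, du.
Qed.
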